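(* Two rank-4 lattices $L_1$, $L_2$ of the space $\mathbb H$, generated respectively by the bases $\{\alpha_1,\alpha_2,\alpha_3,\alpha_4\}$ and $\{\omega_1,\omega_2,\omega_3,\omega_4\}$, determine equivalent tori $T_1=\mathbb H/L_1$, $T_2=\mathbb H/L_2$ if and only if there exist $a\in\mathbb H^*=\mathbb H\setminus\{0\}$ and $A\in GL(4,\mathbb Z)$ such that $$A\begin{pmatrix}\omega_1\\ \omega_2\\ \omega_3\\ \omega_4\end{pmatrix}=\begin{pmatrix}\alpha_1\\ \alpha_2\\ \alpha_3\\ \alpha_4\end{pmatrix}a .$$
   Context: $\mathbb H\cong\mathbb R^4$ is the skew field of quaternions and $\mathbb S=\{q\in\mathbb H: q^2=-1\}$. A function $f:\Omega\to\mathbb H$ on a domain $\Omega\subseteq\mathbb H$ is (slice) regular if for every $I\in\mathbb S$ its restriction $f_I$ to $\Omega\cap(\mathbb R+I\mathbb R)$ has continuous derivatives and $\frac12\left(\frac{\partial}{\partial x}+I\frac{\partial}{\partial y}\right)f_I(x+Iy)=0$. A rank-4 lattice in $\mathbb H$ is the additive subgroup generated by four $\mathbb R$-linearly independent elements (a basis of the lattice). A quaternionic torus is a quotient $T=\mathbb H/L$, $L$ a rank-4 lattice, with the atlas of local inverses of the projection $\pi:\mathbb H\to\mathbb H/L$ on small connected open sets. A map between two quaternionic tori is regular if its expressions in these charts are slice regular; a biregular diffeomorphism is a bijective regular map with regular inverse. Two tori are equivalent if there is a biregular diffeomorphism of one onto the other. $GL(4,\mathbb Z)$ is the group of $4\times4$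 integer matrices with determinant $\pm1$; on the right-hand side each entry of the column is multiplied by $a$ on the right. *)

(* Defs.v *)
From HB Require Import structures.
From mathcomp Require Import all_boot all_order all_algebra.
From mathcomp Require Import all_classical all_reals all_analysis.
From mathcomp Require Import ring lra.
Set Implicit Arguments.
Unset Strict Implicit.
Unset Printing Implicit Defensive.
Import Order.TTheory GRing.Theory Num.Theory.
Import numFieldNormedType.Exports.
Local Open Scope classical_set_scope.
Local Open Scope ring_scope.

(* A quaternion is the row of its coordinates in the basis (1, i, j, k).  The
   norm inherited from row vectors is the sup norm; only the topology, which
   is that of R^4, is used below. *)
Definition quaternion (R : realType) : Type := 'rV[R]_4.

HB.instance Definition _ (R : realType) :=
  NormedModule.on (quaternion R).
HB.instance Definition _ (R : realType) := Complete.on (quaternion R).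
HB.instance Definition _ (R : realType) := Vector.on (quaternion R).

Section QuaternionAlgebra.
Variable R : realType.
Local Notation H := (quaternion R).
Implicit Types (p q : H) (r : R).

Definition quat (a b c d : R) : H := \row_(i < 4) [:: a; b; c; d]`_i.
Definition qcoord q (n : nat) : R := q 0 (inord n).

Lemma qcoord0 a b c d : qcoord (quat a b c d) 0 = a.
Proof. by rewrite /qcoord mxE inordK. Qed.
Lemma qcoord1 a b c d : qcoord (quat a b c d) 1 = b.
Proof. by rewrite /qcoord mxE inordK. Qed.
Lemma qcoord2 a b c d : qcoord (quat a b c d) 2 = c.
Proof. by rewrite /qcoord mxE inordK. Qed.
Lemma qcoord3 a b c d : qcoord (quat a b c d) 3 = d.
Proof. by rewrite /qcoord mxE inordK. Qed.
Definition qcoordE := (qcoord0, qcoord1, qcoord2, qcoord3).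

Lemma qcoordD p q n : qcoord (p + q) n = qcoord p n + qcoord q n.
Proof. by rewrite /qcoord mxE. Qed.
Lemma qcoordZ r q n : qcoord (r *: q) n = r * qcoord q n.
Proof. by rewrite /qcoord mxE. Qed.
Lemma qcoord_0 n : qcoord 0 n = 0.
Proof. by rewrite /qcoord mxE. Qed.

Lemma quatP p q :
  [/\ qcoord p 0 = qcoord q 0, qcoord p 1 = qcoord q 1,
      qcoord p 2 = qcoord q 2 & qcoord p 3 = qcoord q 3] -> p = q.
Proof.
case=> h0 h1 h2 h3; apply/rowP => i; rewrite -[i]inord_val.
by case: i => [[|[|[|[|]]]]].
Qed.

Definition qone : H := quat 1 0 0 0.

Definition qmul p q : H :=
  let a := qcoord p in let b := qcoord q in
  quat (a 0 * b 0 - a 1 * b 1 - a 2 * b 2 - a 3 * b 3)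
       (a 0 * b 1 + a 1 * b 0 + a 2 * b 3 - a 3 * b 2)
       (a 0 * b 2 - a 1 * b 3 + a 2 * b 0 + a 3 * b 1)
       (a 0 * b 3 + a 1 * b 2 - a 2 * b 1 + a 3 * b 0).

Definition qnorm2 q : R :=
  qcoord q 0 ^+ 2 + qcoord q 1 ^+ 2 + qcoord q 2 ^+ 2 + qcoord q 3 ^+ 2.

Definition qinv q : H :=
  let n := qnorm2 q in
  quat (qcoord q 0 / n) (- (qcoord q 1 / n))
       (- (qcoord q 2 / n)) (- (qcoord q 3 / n)).

Lemma qmulA : associative qmul.
Proof. by move=> p q s; apply: quatP; split; rewrite !qcoordE; ring. Qed.
Lemma qmul1q : left_id qone qmul.
Proof. by move=> p; apply: quatP; split; rewrite !qcoordE; ring. Qed.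
Lemma qmulq1 : right_id qone qmul.
Proof. by move=> p; apply: quatP; split; rewrite !qcoordE; ring. Qed.
Lemma qmulDl : left_distributive qmul +%R.
Proof.
by move=> p q s; apply: quatP; split; rewrite !(qcoordD, qcoordE); ring.
Qed.
Lemma qmulDr : right_distributive qmul +%R.
Proof.
by move=> p q s; apply: quatP; split; rewrite !(qcoordD, qcoordE); ring.
Qed.
Lemma qone_neq0 : qone != 0.
Proof.
by apply/eqP => /(congr1 (qcoord^~ 0%N))/eqP; rewrite qcoord0 qcoord_0 oner_eq0.
Qed.

HB.instance Definition _ := GRing.Zmodule_isNzRing.Build H
  qmulA qmul1q qmulq1 qmulDl qmulDr qone_neq0.

Lemma qscaleAl r p q : r *: (p * q) = (r *: p) * q.
Proof. by apply: quatP; split; rewrite !(qcoordZ, qcoordE); ring. Qed.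
HB.instance Definition _ := GRing.Lmodule_isLalgebra.Build R H qscaleAl.

Lemma qscaleAr r p q : r *: (p * q) = p * (r *: q).
Proof. by apply: quatP; split; rewrite !(qcoordZ, qcoordE); ring. Qed.
HB.instance Definition _ := GRing.Lalgebra_isAlgebra.Build R H qscaleAr.

Lemma qnorm2_neq0 q : q != 0 -> qnorm2 q != 0.
Proof.
apply: contra_neq => /eqP; rewrite /qnorm2.
rewrite !paddr_eq0 ?addr_ge0 ?sqr_ge0// !sqrf_eq0.
move=> /andP[/andP[/andP[/eqP h0 /eqP h1] /eqP h2] /eqP h3].
by apply: quatP; rewrite h0 h1 h2 h3 !qcoord_0.
Qed.

Lemma qmulVq : {in [pred q : H | q != 0], left_inverse 1 qinv *%R}.
Proof.
move=> q /qnorm2_neq0 nq0; apply: quatP; move: nq0; rewrite /qnorm2 => nq0.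
by split; rewrite !qcoordE /qnorm2; field.
Qed.
Lemma qmulqV : {in [pred q : H | q != 0], right_inverse 1 qinv *%R}.
Proof.
move=> q /qnorm2_neq0 nq0; apply: quatP; move: nq0; rewrite /qnorm2 => nq0.
by split; rewrite !qcoordE /qnorm2; field.
Qed.
Lemma qunitP p q : q * p = 1 /\ p * q = 1 -> p \in [pred q : H | q != 0].
Proof.
move=> [qp1 _]; rewrite inE; apply: contra_eq_neq qp1 => ->.
by rewrite mulr0 eq_sym oner_neq0.
Qed.
Lemma qinv_out : {in [predC [pred q : H | q != 0]], qinv =1 id}.
Proof.
move=> q; rewrite !inE negbK => /eqP ->.
by apply: quatP; split; rewrite !qcoordE !qcoord_0 mul0r ?oppr0.
Qed.
HB.instance Definition _ := GRing.NzRing_hasMulInverse.Build H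
  qmulVq qmulqV qunitP qinv_out.

End QuaternionAlgebra.

Section SliceRegular.
Variable R : realType.
Local Notation H := (quaternion R).

Definition imag_units : set H := [set I | I ^+ 2 = -1].

Definition slice_point (I : H) (z : R * R) : H := z.1%:A + z.2 *: I.

Definition partial_x (g : R * R -> H) (z : R * R) : H :=
  derive1 (fun x : R => g (x, z.2)) z.1.
Definition partial_y (g : R * R -> H) (z : R * R) : H :=
  derive1 (fun y : R => g (z.1, y)) z.2.

Definition C1_on (D : set (R * R)) (g : R * R -> H) : Prop :=
  [/\ forall z, D z -> derivable (fun x : R => g (x, z.2)) z.1 1,
      forall z, D z -> derivable (fun y : R => g (z.1, y)) z.2 1,
      {within D, continuous (partial_x g)} &
      {within D, continuous (partial_y g)}].

(* Meant for an open set Omega: the values of f outside Omega are then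
   irrelevant.  Omega need not be connected, the condition being local. *)
Definition slice_regular (Omega : set H) (f : H -> H) : Prop :=
  forall I, imag_units I ->
  let D := slice_point I @^-1` Omega in
  let fI := f \o slice_point I in
  C1_on D fI /\
  forall z, D z -> 2^-1 *: (partial_x fI z + I * partial_y fI z) = 0.

End SliceRegular.

Section Lattices.
Variable R : realType.
Local Notation H := (quaternion R).

(* [free] is linear independence over R, [inIntSpan] is membership in the set
   of integral linear combinations. *)
Definition is_lattice_basis (L : set H) (b : 4.-tuple H) : Prop :=
  free b /\ L = inIntSpan b.

Record lattice := Lattice {
  lattice_set :> set H;
  latticeP : exists b : 4.-tuple H, is_lattice_basis lattice_set b
}.

Lemma lattice0 (L : lattice) : lattice_set L 0.
Proof.
case: L => L [b [_ Lb]] /=; rewrite Lb; exists [ffun=> 0].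
by rewrite big1// => i _; rewrite ffunE mulr0z.
Qed.

Lemma latticeB (L : lattice) p q :
  lattice_set L p -> lattice_set L q -> lattice_set L (p - q).
Proof.
case: L => L [b [_ Lb]] /=; rewrite Lb => -[m ->] [n ->].
exists [ffun i => m i - n i]; rewrite -sumrB.
by apply: eq_bigr => i _; rewrite ffunE mulrzBr.
Qed.

End Lattices.

Section Torus.
Variables (R : realType) (L : lattice R).
Local Notation H := (quaternion R).

Definition lattice_rel : rel H := fun p q => `[< lattice_set L (p - q) >].

Lemma lattice_rel_refl : reflexive lattice_rel.
Proof. by move=> p; apply/asboolP; rewrite subrr; exact: lattice0. Qed.

Lemma lattice_rel_sym : symmetric lattice_rel.
Proof.
suff sub p q : lattice_rel p q -> lattice_rel q p.
  by move=> p q; apply/idP/idP; exact: sub.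
move=> /asboolP Lpq; apply/asboolP.
by rewrite -opprB -sub0r; apply: latticeB => //; exact: lattice0.
Qed.

Lemma lattice_rel_trans : transitive lattice_rel.
Proof.
move=> q p s /asboolP Lpq /asboolP Lqs; apply/asboolP.
have -> : p - s = (p - q) - (0 - (q - s)).
  by rewrite sub0r opprK addrA subrK.
by do 2![apply: latticeB => //]; exact: lattice0.
Qed.

Definition lattice_equiv :=
  EquivRel lattice_rel lattice_rel_refl lattice_rel_sym lattice_rel_trans.

Definition torus := quotient_topology {eq_quot lattice_equiv}%qT.

HB.instance Definition _ := Topological.on torus.
HB.instance Definition _ := Quotient.on torus.

Definition torus_proj : H -> torus := \pi_torus%qT.

(* phi is the chart with image V, inverse to the restriction of the projection
   to V, and its domain is [torus_proj @` V]; V is "small" in that the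
   projection is injective on it, as the last condition entails. *)
Definition is_chart (V : set H) (phi : torus -> H) : Prop :=
  [/\ open V, connected V & {in V, cancel torus_proj phi}].

End Torus.
Arguments is_chart {R} L V phi.

Section Maps.
Variable R : realType.
Local Notation H := (quaternion R).

(* The expression of F in the charts phi and psi is psi \o F \o phi^-1, where
   phi^-1 is the projection on V. *)
Definition regular_map (L1 L2 : lattice R) (F : torus L1 -> torus L2) : Prop :=
  continuous F /\
  forall V phi W psi, is_chart L1 V phi -> is_chart L2 W psi ->
    slice_regular
      (V `&` (F \o torus_proj L1) @^-1` (torus_proj L2 @` W))
      (psi \o F \o torus_proj L1).

Definition biregular (L1 L2 : lattice R) (F : torus L1 -> torus L2) : Prop :=
  regular_map F /\
  exists G : torus L2 -> torus L1,
    [/\ cancel F G, cancel G F & regular_map G].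

Definition equivalent_tori (L1 L2 : lattice R) : Prop :=
  exists F : torus L1 -> torus L2, biregular F.

End Maps.

(* Main.v *)
Require Import Defs.
From HB Require Import structures.
From mathcomp Require Import all_boot all_order all_algebra.
From mathcomp Require Import all_classical all_reals all_analysis.
From mathcomp Require Import ring.
Set Implicit Arguments.
Unset Strict Implicit.
Unset Printing Implicit Defensive.
Import Order.TTheory GRing.Theory Num.Theory.
Import numFieldNormedType.Exports.
Local Open Scope classical_set_scope.
Local Open Scope ring_scope.

(** Why the theorem holds.  Let F be a regular map from H/L1 to H/L2 and let phi
    send q to some representative of the image of q, with no continuity asked
    of phi.  Modulo L2, the increment phi (q + v) - phi q depends only on q
    and v; F being uniformly continuous (a ball meets every class modulo L1),
    this increment is congruent to a unique small quaternion w as soon as v is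
    small ([regular_map_unif]).  Fix v in the slice of an imaginary unit I.
    On that slice, w is a bounded function of q, and it is holomorphic, since
    locally it is a difference of two slice regular expressions of F in
    charts.  By Liouville's theorem ([slice_liouville]) it is a constant c v.
    The function c is additive near 0 and differentiable at 0, hence linear
    along each direction ([halving_linear]): its slope is some a along the
    real axis, the same for all slices, and I * a along I, by the
    Cauchy-Riemann equation.  Adding up small steps, phi q is congruent to
    phi 0 + q * a ([affine_lift]).

    Thus F is induced by an affine map q |-> c + q * a
    ([regular_map_affine]).  If F is injective then a is not 0 and right
    multiplication by a maps L1 onto L2 ([injective_regular_map]); writing
    this in the two bases gives the matrix A, whose inverse is obtained in the
    same way and is integral too, so that its determinant is a unit.
    Conversely, A and its inverse show that right multiplication by a carries
    L1 onto L2; it induces a map of tori which, in charts, is locally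
    q |-> q * a + constant ([torus_mul_regular]), and so does right
    multiplication by the inverse of a.

    Liouville's theorem is proved for real Cauchy-Riemann pairs (u, v) of
    class C^1, without integration: for f = u + i v, the average of
    f (a w) / (a w) over the N-th roots of unity w tends to f' 0 as a tends
    to 0, if f 0 = 0, and to 0 as a tends to infinity, if f is bounded, while
    for large N it hardly depends on a in a compact interval
    ([cauchy_riemann_bounded_at0]). *)

(** * Bounded solutions of the Cauchy-Riemann equations *)

Section CauchyRiemann.
Variable R : realType.
Implicit Types (u v : R -> R -> R) (p r : R * R -> R).

Lemma MVT_dist (f df : R -> R) (a b : R) :
  (forall x : R, is_derive x 1 f (df x)) ->
  exists2 c, `|c - a| <= `|b - a| & f b - f a = df c * (b - a).
Proof.
move=> fdf; have fc x : {for x, continuous f}.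
  exact/differentiable_continuous/derivable1_diffP.
have [ab|/ltW ba] := leP a b.
  have [|c /itvP cab fab] := @MVT_segment _ f df a b ab (fun x _ => fdf x).
    exact: continuous_subspaceT.
  by exists c => //; rewrite !ger0_norm ?subr_ge0 ?cab// lerD2r cab.
have [|c /itvP cab fab] := @MVT_segment _ f df b a ba (fun x _ => fdf x).
  exact: continuous_subspaceT.
exists c; last by rewrite -opprB fab -mulrN opprB.
by rewrite !ler0_norm ?subr_le0 ?cab// lerN2 lerD2r cab.
Qed.

Lemma ler_norm_sum_const (N : nat) (f : nat -> R) (w : R) :
  (forall k, (k < N)%N -> `|f k| <= w) -> `|\sum_(k < N) f k| <= N%:R * w.
Proof.
move=> fw; apply: le_trans (ler_norm_sum _ _ _) _.
rewrite mulr_natl -[X in _ *+ X]card_ord -sumr_const.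
by apply: ler_sum => k _; exact: fw.
Qed.

Lemma cvg_pair_comp {T : Type} (F : set_system T) {FF : Filter F}
    (f g : T -> R) (h : R * R -> R) (a b : R) :
  f @ F --> a -> g @ F --> b -> {for (a, b), continuous h} ->
  h (f t, g t) @[t --> F] --> h (a, b).
Proof.
move=> fa gb hc; apply: cvg_trans hc.
exact: (cvg_comp _ h (cvg_pair fa gb)).
Qed.

(** The increment of u is split at the corner (z0.1, z.2).  On each of the two
    legs, the mean value theorem makes the slope a value of a partial
    derivative at an intermediate point, which tends to z0 along with z.
    Continuity of u and the chain rule both follow. *)
Lemma partials_caratheodory u p r (z0 : R * R) :
  (forall a b : R, is_derive a 1 (u^~ b) (p (a, b))) ->
  (forall a b : R, is_derive b 1 (u a) (r (a, b))) ->
  {for z0, continuous p} -> {for z0, continuous r} ->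
  exists P Q : R * R -> R,
    [/\ forall z, u z.1 z.2 - u z0.1 z0.2
                  = P z * (z.1 - z0.1) + Q z * (z.2 - z0.2),
        {for z0, continuous P} /\ P z0 = p z0 &
        {for z0, continuous Q} /\ Q z0 = r z0].
Proof.
case: z0 => x0 y0 ux uy pc rc /=.
have hX (z : R * R) : exists c, `|c - x0| <= `|z.1 - x0| /\
    u z.1 z.2 - u x0 z.2 = p (c, z.2) * (z.1 - x0).
  have [c c1 c2] := @MVT_dist (u^~ z.2) (fun a => p (a, z.2)) x0 z.1
    (fun a => ux a z.2).
  by exists c.
have hY (z : R * R) : exists c, `|c - y0| <= `|z.2 - y0| /\
    u x0 z.2 - u x0 y0 = r (x0, c) * (z.2 - y0).
  have [c c1 c2] := @MVT_dist (u x0) (fun b => r (x0, b)) y0 z.2 (uy x0).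
  by exists c.
have [xi xiP] := choice hX; have [eta etaP] := choice hY.
have squeeze (a : R) (f c : R * R -> R) : f z @[z --> (x0, y0)] --> a ->
    (forall z, `|c z - a| <= `|f z - a|) -> c z @[z --> (x0, y0)] --> a.
  move=> fa cf; apply/cvgrPdist_lt => e e0; move/cvgrPdist_lt : fa => /(_ _ e0).
  by apply: filterS => s; apply: le_lt_trans; rewrite distrC [leRHS]distrC.
have xi0 : xi (x0, y0) = x0.
  have [] := xiP (x0, y0).
  by rewrite subrr normr0 normr_le0 subr_eq0 => /eqP.
have eta0 : eta (x0, y0) = y0.
  have [] := etaP (x0, y0).
  by rewrite subrr normr0 normr_le0 subr_eq0 => /eqP.
have cx : z.1 @[z --> (x0, y0)] --> x0 by exact: cvg_fst.
have cy : z.2 @[z --> (x0, y0)] --> y0 by exact: cvg_snd.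
exists (fun z => p (xi z, z.2)), (fun z => r (x0, eta z)); split.
- by move=> z; rewrite -(xiP z).2 -(etaP z).2 addrA subrK.
- split; last by rewrite xi0.
  rewrite /prop_for /continuous_at /= xi0; apply: cvg_pair_comp cy pc.
  by apply: squeeze cx _ => z; case: (xiP z).
- split; last by rewrite eta0.
  rewrite /prop_for /continuous_at /= eta0; apply: cvg_pair_comp rc.
    exact: cvg_cst.
  by apply: squeeze cy _ => z; case: (etaP z).
Qed.

Lemma continuous_partials u p r :
  (forall a b : R, is_derive a 1 (u^~ b) (p (a, b))) ->
  (forall a b : R, is_derive b 1 (u a) (r (a, b))) ->
  continuous p -> continuous r -> continuous (fun z : R * R => u z.1 z.2).
Proof.
move=> ux uy pc rc z0.
have [P [Q [uE [Pc _] [Qc _]]]] :=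
  partials_caratheodory ux uy (pc z0) (rc z0).
rewrite /continuous_at -[X in _ --> X]add0r.
under eq_fun do rewrite -[u _ _](subrK (u z0.1 z0.2)) uE.
apply: cvgD; last exact: cvg_cst.
rewrite -[X in _ --> X](_ : P z0 * (z0.1 - z0.1) + Q z0 * (z0.2 - z0.2) = 0).
  apply: cvgD; apply: cvgM => //.
    by apply: cvgB; [exact: cvg_fst|exact: cvg_cst].
  by apply: cvgB; [exact: cvg_snd|exact: cvg_cst].
by rewrite !subrr !mulr0 addr0.
Qed.

Lemma is_derive_partials u p r (x y : R -> R) (t dx dy : R) :
  (forall a b : R, is_derive a 1 (u^~ b) (p (a, b))) ->
  (forall a b : R, is_derive b 1 (u a) (r (a, b))) ->
  continuous p -> continuous r ->
  is_derive t 1 x dx -> is_derive t 1 y dy ->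
  is_derive t 1 (fun s => u (x s) (y s))
    (p (x t, y t) * dx + r (x t, y t) * dy).
Proof.
move=> ux uy pc rc xd yd.
have [P [Q [uE [Pc Pp] [Qc Qr]]]] :=
  partials_caratheodory ux uy (pc (x t, y t)) (rc (x t, y t)).
have xc : x s @[s --> t] --> x t.
  exact/differentiable_continuous/derivable1_diffP.
have yc : y s @[s --> t] --> y t.
  exact/differentiable_continuous/derivable1_diffP.
have /is_derive1_caratheodory [gx [gxE gxc <-]] := xd.
have /is_derive1_caratheodory [gy [gyE gyc <-]] := yd.
apply/is_derive1_caratheodory.
exists (fun s => P (x s, y s) * gx s + Q (x s, y s) * gy s); split.
- move=> s; rewrite mulrDl -!mulrA -gxE -gyE.
  exact: (uE (x s, y s)).
- apply: cvgD; apply: cvgM => //.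
    exact: cvg_pair_comp xc yc Pc.
  exact: cvg_pair_comp xc yc Qc.
- by rewrite Pp Qr.
Qed.

Lemma is_derive_mul (f g : R -> R) (x df dg : R) :
  is_derive x 1 f df -> is_derive x 1 g dg ->
  is_derive x 1 (fun y => f y * g y) (df * g x + f x * dg).
Proof.
move=> fd gd; apply: (is_derive_eq (is_deriveM fd gd)).
by rewrite addrC [_ *: df]mulrC.
Qed.

(** That u + i v is holomorphic: p and - r are the real and imaginary parts of
    its complex derivative. *)
Definition cauchy_riemann u v p r : Prop :=
  [/\ forall a b : R, is_derive a 1 (u^~ b) (p (a, b)),
      forall a b : R, is_derive b 1 (u a) (r (a, b)),
      forall a b : R, is_derive a 1 (v^~ b) (- r (a, b)) &
      forall a b : R, is_derive b 1 (v a) (p (a, b))].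

Section Polar.
Variables (u v : R -> R -> R) (p r : R * R -> R).
Hypotheses (CR : cauchy_riemann u v p r).
Hypotheses (pc : continuous p) (rc : continuous r).

(** With f = u + i v, [radial] and [angular] are the real and imaginary parts
    of e^(-it) f (a e^(it)), whose average over t is the Fourier coefficient
    of index 1 of f on the circle of radius a. *)
Definition radial (a t : R) : R :=
  cos t * u (a * cos t) (a * sin t) + sin t * v (a * cos t) (a * sin t).
Definition angular (a t : R) : R :=
  cos t * v (a * cos t) (a * sin t) - sin t * u (a * cos t) (a * sin t).
Definition angular_rate (a t : R) : R :=
  a * p (a * cos t, a * sin t) - radial a t.

Let NrC : continuous (fun z => - r z).
Proof. by move=> z; apply: continuousN; exact: rc. Qed.

(** The factor e^(-it) cancels the e^(it) that the chain rule produces, so that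
    only the real part of the complex derivative is left. *)
Lemma is_derive_radial (a t : R) :
  is_derive a 1 (radial^~ t) (p (a * cos t, a * sin t)).
Proof.
have [ux uy vx vy] := CR.
have dZ (c : R) : is_derive a 1 (fun b : R => b * c) c.
  by apply: is_derive_eq (is_derive_mul _ _) _; rewrite mul1r mulr0 addr0.
have du := is_derive_partials ux uy pc rc (dZ (cos t)) (dZ (sin t)).
have dv := is_derive_partials vx vy NrC pc (dZ (cos t)) (dZ (sin t)).
have hu := is_derive_mul (is_derive_cst (cos t) a 1) du.
have hv := is_derive_mul (is_derive_cst (sin t) a 1) dv.
apply: (is_derive_eq (is_deriveD hu hv)).
rewrite /= !mul0r !add0r; set P := p _; set Q := r _.
rewrite -[RHS]mul1r -(cos2Dsin2 t); ring.
Qed.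

Lemma is_derive_angular (a t : R) :
  is_derive t 1 (angular a) (angular_rate a t).
Proof.
have [ux uy vx vy] := CR.
have dc : is_derive t 1 (fun s => a * cos s) (- (a * sin t)).
  by apply: is_derive_eq (is_derive_mul _ _) _; rewrite mul0r add0r mulrN.
have ds : is_derive t 1 (fun s => a * sin s) (a * cos t).
  by apply: is_derive_eq (is_derive_mul _ _) _; rewrite mul0r add0r.
have du := is_derive_partials ux uy pc rc dc ds.
have dv := is_derive_partials vx vy NrC pc dc ds.
have hv := is_derive_mul (is_derive_cos t) dv.
have hu := is_derive_mul (is_derive_sin t) du.
apply: (is_derive_eq (is_deriveB hv hu)).
rewrite /angular_rate /radial; set P := p _; set Q := r _.
rewrite -[X in _ = X - _]mulr1 -(cos2Dsin2 t); ring.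
Qed.

Lemma continuous_angular_rate :
  continuous (fun z : R * R => angular_rate z.1 z.2).
Proof.
have [ux uy vx vy] := CR.
have cz : continuous (fun z : R * R => z.1 * cos z.2).
  move=> z; apply: cvgM; first exact: cvg_fst.
  by apply: (cvg_comp _ _ cvg_snd); exact: continuous_cos.
have sz : continuous (fun z : R * R => z.1 * sin z.2).
  move=> z; apply: cvgM; first exact: cvg_fst.
  by apply: (cvg_comp _ _ cvg_snd); exact: continuous_sin.
have uc := continuous_partials ux uy pc rc.
have vc := continuous_partials vx vy NrC pc.
move=> z; apply: cvgB.
  apply: cvgM; first exact: cvg_fst.
  by apply: (cvg_pair_comp (cz z) (sz z)); exact: pc.
apply: cvgD; apply: cvgM.
- by apply: (cvg_comp _ _ cvg_snd); exact: continuous_cos.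
- by apply: (cvg_pair_comp (h := fun z => u z.1 z.2) (cz z) (sz z)); exact: uc.
- by apply: (cvg_comp _ _ cvg_snd); exact: continuous_sin.
- by apply: (cvg_pair_comp (h := fun z => v z.1 z.2) (cz z) (sz z)); exact: vc.
Qed.

Lemma angular_rate_unif (a0 a1 e : R) : 0 < e ->
  exists2 d : R, 0 < d & forall a t s : R, a0 <= a <= a1 -> 0 <= t <= pi *+ 2 ->
    `|s - t| <= d -> `|angular_rate a s - angular_rate a t| <= e.
Proof.
move=> e0; pose D : set (R * R) := `[a0, a1] `*` `[0, pi *+ 2].
have cD : compact D by apply: compact_setX; exact: segment_compact.
pose P (d : R) (z : R * R) := forall s : R, `|s - z.2| <= d ->
  `|angular_rate z.1 s - angular_rate z.1 z.2| <= e.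
have : \forall d \near 0^'+, D `<=` P d.
  move/compact_near_coveringP : cD; apply => z _.
  have /cvgrPdist_lt /(_ (e / 2)) := @continuous_angular_rate z.
  rewrite divr_gt0// => /(_ isT) /nbhs_ballP[b /= b0 bP].
  exists (ball z (b / 2), [set d | d < b / 2]) => /=.
    split; first by apply: nbhsx_ballx; rewrite divr_gt0.
    by apply: nbhs_right_lt; rewrite divr_gt0.
  move=> [z' d] /= [[z1 z2] db] s sd.
  have bb : b / 2 <= b by rewrite ler_pdivrMr// ler_peMr ?ltW// ltr1n.
  have h1 : ball z b z' by split; apply: (le_ball bb).
  have h2 : ball z b (z'.1, s).
    split; first exact: (le_ball bb).
    rewrite [b]splitr; apply: ball_triangle z2 _.
    by rewrite /ball /= distrC; apply: le_lt_trans sd db.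
  rewrite [e]splitr -(subrKA (angular_rate z.1 z.2)).
  apply: le_trans (ler_normD _ _) _; apply: lerD; apply: ltW.
    by rewrite distrC; exact: bP h2.
  exact: bP h1.
move=> nP; have [d [/= d0 dP]] : exists d : R, 0 < d /\ D `<=` P d.
  near (0 : R)^'+ => d; exists d; split; first by near: d; exact: nbhs_right_gt.
  by near: d.
exists d => // a t s ha ht; apply: (dP (a, t)).
by split; rewrite /= in_itv.
Unshelve. all: by end_near. Qed.

(** This plays the part of the vanishing of the integral of [angular_rate] over
    a full turn.  The increments of [angular] over N equal arcs add up to 0,
    by periodicity, and by the mean value theorem each is h times a value of
    [angular_rate] inside its arc.  So the sum of these intermediate values
    is 0, and moving them to the mesh points costs at most w for each arc. *)
Lemma sum_angular_rate (a w : R) (N : nat) : (0 < N)%N ->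
  let h := pi *+ 2 / N%:R in
  (forall k s, (k < N)%N -> `|s - h * k%:R| <= h ->
    `|angular_rate a s - angular_rate a (h * k%:R)| <= w) ->
  `|\sum_(k < N) angular_rate a (h * k%:R)| <= N%:R * w.
Proof.
move=> N0 h hw; have NR0 : N%:R != 0 :> R by rewrite pnatr_eq0 -lt0n.
have h0 : 0 < h by rewrite divr_gt0 ?ltr0n// pmulrn_lgt0// pi_gt0.
have hX (k : nat) : exists c, `|c - h * k%:R| <= h /\
    angular a (h * k.+1%:R) - angular a (h * k%:R) = angular_rate a c * h.
  have [c c1 c2] := @MVT_dist (angular a) (angular_rate a) (h * k%:R)
    (h * k.+1%:R) (is_derive_angular a).
  have hh : h * k.+1%:R - h * k%:R = h by rewrite -natr1; ring.
  by exists c; rewrite hh in c1 c2; rewrite (le_trans c1)// gtr0_norm.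
have [xi xiP] := choice hX.
have sum0 : \sum_(k < N) angular_rate a (xi k) = 0.
  apply: (mulIf (lt0r_neq0 h0)); rewrite mul0r mulr_suml.
  under eq_bigr => k _ do rewrite -(xiP k).2.
  rewrite -(big_mkord xpredT
    (fun k => angular a (h * k.+1%:R) - angular a (h * k%:R))).
  rewrite telescope_sumr// /h mulfVK// mulr0 /angular.
  by rewrite cos2pi sin2pi cos0 sin0 subrr.
rewrite -[X in `|X|]subr0 -[X in _ - X]sum0 -sumrB.
apply: (@ler_norm_sum_const _ (fun k => angular_rate a (h * k%:R)
  - angular_rate a (xi k))) => k kN.
by rewrite distrC; apply: hw => //; case: (xiP k).
Qed.

(** N times a discrete version of the Fourier coefficient of index 1, divided
    by the radius. *)
Definition radial_sum (N : nat) (a : R) : R :=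
  (\sum_(k < N) radial a (pi *+ 2 / N%:R * k%:R)) / a.

(** The derivative of [radial] / a with respect to a is [angular_rate] / a ^ 2,
    whose sum over the mesh is small by [sum_angular_rate]: the sum
    [radial_sum N a] is almost independent of a. *)
Lemma radial_sum_le (N : nat) (a0 a1 w : R) : 0 < a0 -> a0 <= a1 ->
  (forall a t, a0 <= a <= a1 -> 0 <= t <= pi *+ 2 -> forall s,
    `|s - t| <= pi *+ 2 / N%:R ->
    `|angular_rate a s - angular_rate a t| <= w) ->
  (0 < N)%N ->
  `|radial_sum N a1 - radial_sum N a0| <= N%:R * w / a0 ^+ 2 * (a1 - a0).
Proof.
move=> a00 a01 hw N0; pose S := radial_sum N; rewrite -/(S a0) -/(S a1).
set h := pi *+ 2 / N%:R in hw.
have h0 : 0 < h by rewrite divr_gt0 ?ltr0n// pmulrn_lgt0// pi_gt0.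
have NR0 : N%:R != 0 :> R by rewrite pnatr_eq0 -lt0n.
have dS (a : R) : 0 < a ->
    is_derive a 1 S ((\sum_(k < N) angular_rate a (h * k%:R)) / a ^+ 2).
  move=> ap; have an0 : a != 0 by rewrite gt_eqF.
  have d1 := is_derive_sum (fun k : 'I_N => is_derive_radial a (h * k%:R)).
  have d2 := is_deriveV an0 (is_derive_id a 1).
  have := is_derive_mul d1 d2.
  rewrite [X in is_derive _ _ X _ -> _](_ : _ = S); last first.
    by apply/funext => b; rewrite /S fct_sumE.
  move=> /is_derive_eq; apply.
  rewrite /angular_rate sumrB -mulr_sumr fct_sumE.
  set A := \sum_(i < N) _; set B := \sum_(i < N) _.
  by rewrite /= [_ *: _]mulr1; field.
have [||c /itvP ca ->] := @MVT_segment _ S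
    (fun a => (\sum_(k < N) angular_rate a (h * k%:R)) / a ^+ 2) a0 a1 a01.
- by move=> x /itvP xa; apply: dS; rewrite (lt_trans a00)// xa.
- apply: derivable_within_continuous => x; rewrite in_itv /= => /andP[a0x _].
  by have [] := dS x (lt_le_trans a00 a0x).
rewrite normrM [X in _ * X]ger0_norm ?subr_ge0//.
apply: ler_wpM2r; first by rewrite subr_ge0.
have c0 : 0 < c by rewrite (lt_le_trans a00)// ca.
rewrite normrM normfV [X in _ / X]ger0_norm ?exprn_ge0 ?(ltW c0)//.
have w0 : 0 <= w.
  apply: le_trans (hw a0 0 _ _ 0 _);
    rewrite ?normr_ge0 ?lexx ?subrr ?normr0 ?(ltW h0)//.
  by rewrite mulrn_wge0// pi_ge0.
apply: ler_pM; rewrite ?invr_ge0 ?exprn_ge0// ?(ltW c0)//.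
  apply: sum_angular_rate => // k s kN; apply: hw; first by rewrite !ca.
  rewrite mulr_ge0 ?(ltW h0)//= /h mulrAC ler_pdivrMr ?ltr0n//.
  by rewrite ler_wpM2l ?ler_nat ?(ltnW kN)// mulrn_wge0// pi_ge0.
rewrite lef_pV2 ?posrE ?exprn_gt0//.
by rewrite ler_pXn2r ?nnegrE ?(ltW c0) ?(ltW a00)// ca.
Qed.

(** [radial_sum N a] / N is close to p (0, 0) for small a, is at most 2 M / a in
    absolute value, and hardly varies between these two regimes when N is
    large. *)
Lemma cauchy_riemann_bounded_at0 (M : R) :
  (forall a b, `|u a b| <= M) -> (forall a b, `|v a b| <= M) ->
  u 0 0 = 0 -> v 0 0 = 0 -> p (0, 0) = 0.
Proof.
move=> uM vM u0 v0; apply/normr0_eq0/eqP; rewrite eq_le normr_ge0 andbT.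
apply/ler_addgt0Pr => e e0; rewrite add0r.
have [e' e'0 eE] : exists2 e', 0 < e' & e = e' + e' + e'.
  by exists (e / 3); [rewrite divr_gt0|field].
have M0 : 0 <= M by apply: le_trans (uM 0 0).
(* A radius d so small that p is within e' of p (0, 0) on its disc: then so is
   radial d t / d, which is a value of p on a ray by the mean value theorem. *)
have [d d0 dP] : exists2 d : R, 0 < d &
    forall b t : R, `|b| <= d -> `|p (b * cos t, b * sin t) - p (0, 0)| <= e'.
  have /cvgrPdist_lt /(_ e' e'0) /nbhs_ballP[b /= b0 bP] := @pc (0, 0).
  exists (b / 2); first by rewrite divr_gt0.
  move=> c t cb; rewrite distrC; apply/ltW/bP.
  have cb' : `|c| < b.
    by apply: le_lt_trans cb _; rewrite ltr_pdivrMr// ltr_pMr// ltr1n.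
  split; rewrite /ball /= sub0r normrN normrM; apply: le_lt_trans cb'.
    by rewrite ler_piMr// cos_max.
  by rewrite ler_piMr// sin_max.
have radial0 (t : R) : `|radial d t / d - p (0, 0)| <= e'.
  have [c c1 c2] := @MVT_dist (radial^~ t)
    (fun a => p (a * cos t, a * sin t)) 0 d (is_derive_radial^~ t).
  have r0 : radial 0 t = 0 by rewrite /radial !mul0r u0 v0 !mulr0 addr0.
  rewrite r0 !subr0 in c1 c2; rewrite c2 mulfK ?gt_eqF//.
  by apply: dP; rewrite (le_trans c1)// gtr0_norm.
(* A radius so large that 2 * M / a1 is at most e'. *)
pose a1 := d + 2 * M / e'.
have da1 : d <= a1 by rewrite lerDl !mulr_ge0// invr_ge0 ltW.
have a10 : 0 < a1 by apply: lt_le_trans da1.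
have radial1 (t : R) : `|radial a1 t / a1| <= e'.
  rewrite normrM normfV (gtr0_norm a10) ler_pdivrMr//.
  apply: (@le_trans _ _ (2 * M)).
    rewrite mulr_natl mulr2n; apply: le_trans (ler_normD _ _) _.
    by apply: lerD; rewrite normrM; apply: le_trans (ler_piMl _ _) _;
      rewrite ?cos_max ?sin_max.
  by rewrite /a1 mulrDr mulrCA divff ?gt_eqF// mulr1 lerDr mulr_ge0// ltW.
have den0 : 0 < 1 + (a1 - d) by rewrite ltr_wpDr ?subr_ge0.
(* The oscillation for which the bound of radial_sum_le is at most N * e'; the
   summand 1 keeps the denominator positive. *)
have [w w0 wE] : exists2 w, 0 < w & w * (1 + (a1 - d)) = e' * d ^+ 2.
  exists (e' * d ^+ 2 / (1 + (a1 - d))); last by rewrite mulfVK ?gt_eqF.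
  by rewrite divr_gt0 ?mulr_gt0 ?exprn_gt0.
have [m m0 mP] := angular_rate_unif d a1 w0.
have [N N0 Nm] : exists2 N : nat, (0 < N)%N & pi *+ 2 / N%:R <= m.
  exists (Num.truncn (pi *+ 2 / m)).+1 => //.
  rewrite ler_pdivrMr ?ltr0n// mulrC -ler_pdivrMr//; apply: ltW.
  exact: truncnS_gt.
have NR0 : 0 < N%:R :> R by rewrite ltr0n.
have rs := radial_sum_le d0 da1
  (fun a t ha ht s hs => mP a t s ha ht (le_trans hs Nm)) N0.
have S1 : `|radial_sum N a1| <= N%:R * e'.
  rewrite /radial_sum mulr_suml.
  exact: (@ler_norm_sum_const _
    (fun k => radial a1 (pi *+ 2 / N%:R * k%:R) / a1)).
have S0 : `|N%:R * p (0, 0) - radial_sum N d| <= N%:R * e'.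
  have -> : N%:R * p (0, 0) = \sum_(k < N) p (0, 0).
    by rewrite sumr_const card_ord mulr_natl.
  rewrite /radial_sum mulr_suml -sumrB.
  apply: (@ler_norm_sum_const _
    (fun k => p (0, 0) - radial d (pi *+ 2 / N%:R * k%:R) / d)) => k _.
  by rewrite distrC.
have S2 : `|radial_sum N a1 - radial_sum N d| <= N%:R * e'.
  apply: le_trans rs _.
  rewrite mulrAC ler_pdivrMr ?exprn_gt0// -!mulrA ler_pM2l//.
  by rewrite -wE; apply: ler_wpM2l; rewrite ?(ltW w0)// lerDr.
rewrite -(ler_pM2l NR0) -[N%:R in leLHS]gtr0_norm// -normrM.
have -> : N%:R * e = N%:R * e' + N%:R * e' + N%:R * e' by rewrite eE !mulrDr.
have -> : N%:R * p (0, 0) = (N%:R * p (0, 0) - radial_sum N d)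
  - (radial_sum N a1 - radial_sum N d) + radial_sum N a1 by ring.
apply: le_trans (ler_normD _ _) _; apply: lerD => //.
by apply: le_trans (ler_normB _ _) _; apply: lerD.
Qed.

End Polar.

Lemma is_derive_shift_sub (f : R -> R) (a b c d : R) :
  is_derive (b + a) 1 f d -> is_derive b 1 (fun x => f (x + a) - c) d.
Proof.
move=> fd; have sd : is_derive b 1 (fun x : R => x + a) (1 : R).
  have := is_deriveD (is_derive_id b 1) (is_derive_cst a b 1).
  by rewrite addr0.
have := is_deriveB (@is_derive1_comp _ f (fun x => x + a) b _ _ fd sd)
  (is_derive_cst c b 1).
by rewrite mulr1 subr0.
Qed.

Lemma bounded_cauchy_riemann_eq0 u v p r (M : R) :
  cauchy_riemann u v p r -> continuous p -> continuous r ->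
  (forall a b, `|u a b| <= M) -> (forall a b, `|v a b| <= M) ->
  forall z, p z = 0.
Proof.
move=> [ux uy vx vy] pc rc uM vM [a b].
have sc (f : R * R -> R) : continuous f ->
    continuous (fun z : R * R => f (z.1 + a, z.2 + b)).
  move=> fc z; apply: (@cvg_pair_comp _ (nbhs z) _
    (fun z => z.1 + a) (fun z => z.2 + b)).
  - by apply: cvgD; [exact: cvg_fst|exact: cvg_cst].
  - by apply: cvgD; [exact: cvg_snd|exact: cvg_cst].
  - exact: fc.
have := @cauchy_riemann_bounded_at0 (fun x y => u (x + a) (y + b) - u a b)
  (fun x y => v (x + a) (y + b) - v a b)
  (fun z => p (z.1 + a, z.2 + b)) (fun z => r (z.1 + a, z.2 + b)) _ (sc _ pc)
  (sc _ rc) (M + M).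
rewrite /= !add0r !subrr; apply=> //.
- split=> x y /=.
  + exact: is_derive_shift_sub (ux (x + a) (y + b)).
  + exact: is_derive_shift_sub (uy (x + a) (y + b)).
  + exact: is_derive_shift_sub (vx (x + a) (y + b)).
  + exact: is_derive_shift_sub (vy (x + a) (y + b)).
- by move=> x y; apply: le_trans (ler_normB _ _) _; apply: lerD.
- by move=> x y; apply: le_trans (ler_normB _ _) _; apply: lerD.
Qed.

(** Multiplication of u + i v by - i, which carries results on p over to r. *)
Lemma cauchy_riemann_rot u v p r : cauchy_riemann u v p r ->
  cauchy_riemann v (fun x y => - u x y) (fun z => - r z) p.
Proof.
by move=> [ux uy vx vy]; split=> a b //; apply: is_deriveN.
Qed.

Lemma bounded_cauchy_riemann_cst u v p r (M : R) :
  cauchy_riemann u v p r -> continuous p -> continuous r ->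
  (forall a b, `|u a b| <= M) -> (forall a b, `|v a b| <= M) ->
  forall a b, u a b = u 0 0.
Proof.
move=> CR pc rc uM vM a b.
have p0 := bounded_cauchy_riemann_eq0 CR pc rc uM vM.
have rNc : continuous (fun z => - r z).
  by move=> z; apply: continuousN; exact: rc.
have r0 z : r z = 0.
  apply/oppr_inj; rewrite oppr0.
  apply: (bounded_cauchy_riemann_eq0 (cauchy_riemann_rot CR) rNc pc vM).
  by move=> x y; rewrite normrN.
have [ux uy _ _] := CR.
have -> : u a b = u a 0.
  by apply: is_derive_0_is_cst => y; have := uy a y; rewrite r0.
by apply: (@is_derive_0_is_cst _ (u^~ 0)) => x; have := ux x 0; rewrite p0.
Qed.

End CauchyRiemann.

(** * Norm and continuity of the quaternion operations *)

Lemma dist_continuous (R : realType) (V W : normedModType R) (f : V -> W)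
    (C : R) :
  (forall x y, `|f x - f y| <= C * `|x - y|) -> continuous f.
Proof.
move=> fC x; apply/cvgrPdist_lt => e e0; near=> y.
apply: le_lt_trans (fC _ _) _.
have C0 : 0 < `|C| + 1 by rewrite ltr_wpDl.
apply: (@le_lt_trans _ _ ((`|C| + 1) * `|x - y|)).
  by rewrite ler_wpM2r// ler_wpDr// ler_norm.
rewrite mulrC -ltr_pdivlMr//; near: y.
by apply: cvgr_dist_lt; [exact: cvg_id|rewrite divr_gt0].
Unshelve. all: by end_near. Qed.

Section QuaternionNorm.
Variable R : realType.
Local Notation H := (quaternion R).
Implicit Types p q a : H.

Lemma ler_qcoord q n : `|qcoord q n| <= `|q|.
Proof.
rewrite [leRHS]/Num.Def.normr/= mx_normrE.
exact: (le_bigmax _ (fun ij => `|q ij.1 ij.2|) (0, inord n)).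
Qed.

Lemma qnorm_le q (C : R) : 0 <= C -> 
    (forall n, (n < 4)%N -> `|qcoord q n| <= C) -> `|q| <= C.
Proof.
move=> C0 qC; rewrite /Num.Def.normr/= mx_normrE.
rewrite (bigmax_le _ C0)//= => -[i j] _.
by rewrite /= ord1 -(inord_val j); exact: qC (ltn_ord j).
Qed.

(** Each coordinate of a product is a signed sum of four products of
    coordinates, and the norm is the sup norm; hence the factor 4. *)
Lemma qnorm_mul_le p q : `|p * q| <= 4 * `|p| * `|q|.
Proof.
have pq m n : `|qcoord p m * qcoord q n| <= `|p| * `|q|.
  by rewrite normrM ler_pM ?ler_qcoord.
have bnd (a b c d : R) (C : R) : `|a| <= C -> `|b| <= C -> `|c| <= C ->
    `|d| <= C -> `|a + b + c + d| <= 4 * C.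
  move=> aC bC cC dC; apply: le_trans (ler_normD _ _) _.
  have -> : 4 * C = C + C + C + C by ring.
  apply: lerD => //; apply: le_trans (ler_normD _ _) _.
  by apply: lerD => //; apply: le_trans (ler_normD _ _) _; apply: lerD.
have c0 : 0 <= 4 * `|p| * `|q| by rewrite !mulr_ge0.
rewrite -mulrA in c0 *.
apply: qnorm_le => // n n4.
by case: n n4 => [|[|[|[|//]]]] _; rewrite ?qcoordE; apply: bnd;
  rewrite ?normrN.
Qed.

Lemma qmulr_continuous a : continuous (fun q : H => q * a).
Proof.
apply: (@dist_continuous _ _ _ _ (4 * `|a|)) => p q.
by rewrite -mulrBl; apply: le_trans (qnorm_mul_le _ _) _; rewrite mulrAC.
Qed.

Lemma qcoord_continuous n : continuous (fun q : H => qcoord q n).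
Proof.
apply: (@dist_continuous _ H R^o _ 1) => p q; rewrite mul1r.
have -> : qcoord p n - qcoord q n = qcoord (p - q) n.
  by rewrite /qcoord !mxE.
exact: ler_qcoord.
Qed.

End QuaternionNorm.

Section Derivative.
Variable R : realType.
Implicit Types V W : normedModType R.

Lemma is_derive_linear V W (l : {linear V -> W}) (f : R -> V) (x : R) (d : V) :
  continuous l -> is_derive x 1 f d -> is_derive x 1 (l \o f) (l d).
Proof.
move=> lc [fx <-].
have lcvg : h^-1 *: ((l \o f \o shift x) (h *: 1) - (l \o f) x)
    @[h --> 0^'] --> l ('D_1 f x).
  have := cvg_comp _ _ fx (lc ('D_1 f x)); apply: cvg_trans; apply: near_eq_cvg.
  by near=> h; rewrite /= linearZ linearB.
by constructor; [apply/cvg_ex; exists (l ('D_1 f x))|exact: cvg_lim lcvg].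
Unshelve. all: by end_near. Qed.

Lemma derivable_shift V (f : R -> V) (a x : R) :
  derivable f (x + a) 1 -> derivable (fun y => f (y + a)) x 1.
Proof.
rewrite /derivable => fx; rewrite [X in X @ _](_ : _ =
  fun h => h^-1 *: ((f \o shift (x + a)) (h *: 1) - f (x + a))) //.
by apply/funext => h /=; rewrite addrA.
Qed.

Lemma derive1_shift V (f : R -> V) (a x : R) :
  derive1 (fun y => f (y + a)) x = derive1 f (x + a).
Proof.
rewrite /derive1; under eq_fun do rewrite -addrA.
by [].
Qed.

End Derivative.

(** * Holomorphic functions on a slice *)

Lemma near_eq_continuous (T U : topologicalType) (f g : T -> U) (x : T) :
  (\forall y \near x, f y = g y) ->
  {for x, continuous f} -> {for x, continuous g}.
Proof.
move=> fg fx; rewrite /prop_for /continuous_at -(nbhs_singleton fg).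
by apply: cvg_trans fx; exact: near_eq_cvg.
Qed.

Lemma within_open_continuous (T U : topologicalType) (A : set T) (f : T -> U)
    (x : T) :
  open A -> A x -> {within A, continuous f} -> {for x, continuous f}.
Proof.
by move=> oA Ax; rewrite continuous_open_subspace//; apply; rewrite inE.
Qed.

Lemma near_addr (R : realType) (V : normedModType R) (P : set V) (x v : V) :
  (\forall y \near x + v, P y) -> \forall y \near x, P (y + v).
Proof.
have shc : y + v @[y --> x] --> x + v.
  by apply: cvgD; [exact: cvg_id|exact: cvg_cst].
exact: shc.
Qed.

Lemma continuous_addr (R : realType) (V : normedModType R) (U : topologicalType)
    (f : V -> U) (x v : V) :
  {for x + v, continuous f} -> {for x, continuous (fun y => f (y + v))}.
Proof.
move=> fc; have shc : y + v @[y --> x] --> x + v.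
  by apply: cvgD; [exact: cvg_id|exact: cvg_cst].
exact: (cvg_comp _ _ shc fc).
Qed.

Lemma continuous_plane (R : realType) (V : normedModType R) (a b : V) :
  continuous (fun z : R * R => z.1 *: a + z.2 *: b).
Proof.
by move=> z; apply: cvgD; apply: cvgZr_tmp; [exact: cvg_fst|exact: cvg_snd].
Qed.

Section SliceHolomorphic.
Variable R : realType.
Local Notation H := (quaternion R).
Implicit Types (I c : H) (k : R * R -> H) (z w : R * R).

Lemma near_pair (P : set (R * R)) z : (\forall w \near z, P w) ->
  (\forall x \near z.1, P (x, z.2)) /\ (\forall y \near z.2, P (z.1, y)).
Proof.
move=> /nbhs_ballP[e /= e0 eP]; split; apply/nbhs_ballP; exists e => //= x xe;
  by apply: eP; split => //; exact: ballxx.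
Qed.

Definition slice_derivable k z : Prop :=
  derivable (fun x : R => k (x, z.2)) z.1 1 /\
  derivable (fun y : R => k (z.1, y)) z.2 1.

(** The requirements of [slice_regular], as a property of the germ of k at z: in
    this form they pass to functions that agree near z, to translates and to
    differences. *)
Definition slice_holomorphic_at I k z : Prop :=
  [/\ \forall w \near z, slice_derivable k w,
      \forall w \near z, partial_x k w + I * partial_y k w = 0,
      {for z, continuous (partial_x k)} & {for z, continuous (partial_y k)}].

Lemma slice_holomorphic_near I k k' z : (\forall w \near z, k w = k' w) ->
  slice_holomorphic_at I k z -> slice_holomorphic_at I k' z.
Proof.
move=> /nbhs_interior kk' [kd kCR kx ky].
have xE : \forall w \near z, partial_x k w = partial_x k' w.
  apply: filterS kk' => w /near_pair[wx _].
  by rewrite /partial_x !derive1E; exact: near_eq_derive.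
have yE : \forall w \near z, partial_y k w = partial_y k' w.
  apply: filterS kk' => w /near_pair[_ wy].
  by rewrite /partial_y !derive1E; exact: near_eq_derive.
split.
- apply: filterS2 kk' kd => w /near_pair[wx wy] [dx dy].
  by split; [apply: near_eq_derivable dx|apply: near_eq_derivable dy].
- by apply: filterS3 xE yE kCR => w <- <-.
- exact: (@near_eq_continuous (R * R)%type H _ _ _ xE kx).
- exact: (@near_eq_continuous (R * R)%type H _ _ _ yE ky).
Qed.

Lemma slice_derivable_shift k z v :
  slice_derivable k (z + v) -> slice_derivable (fun w => k (w + v)) z.
Proof.
move=> [dx dy]; split.
- exact: (@derivable_shift _ _ (fun x => k (x, z.2 + v.2)) v.1 z.1 dx).
- exact: (@derivable_shift _ _ (fun y => k (z.1 + v.1, y)) v.2 z.2 dy).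
Qed.

Lemma partial_x_shift k v z :
  partial_x (fun w => k (w + v)) z = partial_x k (z + v).
Proof.
exact: (@derive1_shift _ _ (fun x => k (x, z.2 + v.2)) v.1 z.1).
Qed.

Lemma partial_y_shift k v z :
  partial_y (fun w => k (w + v)) z = partial_y k (z + v).
Proof.
exact: (@derive1_shift _ _ (fun y => k (z.1 + v.1, y)) v.2 z.2).
Qed.

Lemma slice_holomorphic_shift I k z v : slice_holomorphic_at I k (z + v) ->
  slice_holomorphic_at I (fun w => k (w + v)) z.
Proof.
move=> [kd kCR kx ky].
have xE : partial_x (fun w => k (w + v)) = (fun w => partial_x k (w + v)).
  by apply/funext => w; exact: partial_x_shift.
have yE : partial_y (fun w => k (w + v)) = (fun w => partial_y k (w + v)).
  by apply/funext => w; exact: partial_y_shift.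
split.
- apply: filterS (near_addr kd) => w; exact: slice_derivable_shift.
- by rewrite xE yE; exact: (near_addr kCR).
- rewrite xE; exact: (@continuous_addr R (R * R)%type H (partial_x k) z v kx).
- rewrite yE; exact: (@continuous_addr R (R * R)%type H (partial_y k) z v ky).
Qed.

Lemma slice_holomorphic_sub I k k' c z :
  slice_holomorphic_at I k z -> slice_holomorphic_at I k' z ->
  slice_holomorphic_at I (fun w => k w - k' w - c) z.
Proof.
move=> [kd kCR kx ky] [kd' kCR' kx' ky'].
have dE w : slice_derivable k w -> slice_derivable k' w ->
    [/\ slice_derivable (fun w => k w - k' w - c) w,
       partial_x (fun w => k w - k' w - c) w = partial_x k w - partial_x k' w &
       partial_y (fun w => k w - k' w - c) w = partial_y k w - partial_y k' w].
  move=> [dx dy] [dx' dy'].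
  have dB (f g : R -> H) (x : R) : derivable f x 1 -> derivable g x 1 ->
      is_derive x 1 (fun x => f x - g x - c) (derive1 f x - derive1 g x).
    rewrite !derive1E => /derivableP fx /derivableP gx.
    have := is_deriveB (is_deriveB fx gx) (is_derive_cst c x 1).
    by rewrite subr0.
  have hx := dB _ _ _ dx dx'; have hy := dB _ _ _ dy dy'.
  split; first by split; [case: hx|case: hy].
  - by rewrite /partial_x derive1E derive_val.
  - by rewrite /partial_y derive1E derive_val.
have dE1 w (d : slice_derivable k w) (d' : slice_derivable k' w) :=
  let: And3 h _ _ := dE w d d' in h.
have dE2 w (d : slice_derivable k w) (d' : slice_derivable k' w) :=
  let: And3 _ h _ := dE w d d' in esym h.
have dE3 w (d : slice_derivable k w) (d' : slice_derivable k' w) :=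
  let: And3 _ _ h := dE w d d' in esym h.
have xE := @filterS2 _ (nbhs z) (nbhs_filter z) _ _ _ dE2 kd kd'.
have yE := @filterS2 _ (nbhs z) (nbhs_filter z) _ _ _ dE3 kd kd'.
split.
- exact: (@filterS2 _ (nbhs z) (nbhs_filter z) _ _ _ dE1 kd kd').
- have CRE w : partial_x k w + I * partial_y k w = 0 ->
      partial_x k' w + I * partial_y k' w = 0 ->
      (partial_x k w - partial_x k' w) +
      I * (partial_y k w - partial_y k' w) = 0.
    by move=> c1 c2; rewrite mulrBr addrACA -opprD c1 c2 subrr.
  have CR := @filterS2 _ (nbhs z) (nbhs_filter z) _ _ _ CRE kCR kCR'.
  have CRB w : partial_x k w - partial_x k' w =
        partial_x (fun w => k w - k' w - c) w ->
      partial_y k w - partial_y k' w =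
        partial_y (fun w => k w - k' w - c) w ->
      (partial_x k w - partial_x k' w) +
        I * (partial_y k w - partial_y k' w) = 0 ->
      partial_x (fun w => k w - k' w - c) w +
        I * partial_y (fun w => k w - k' w - c) w = 0.
    by move=> <- <-.
  exact: (@filterS3 _ (nbhs z) (nbhs_filter z) _ _ _ _ CRB xE yE CR).
- exact: (@near_eq_continuous (R * R)%type H _ _ _ xE
    (@continuousB R H (R * R)%type _ _ z kx kx')).
- exact: (@near_eq_continuous (R * R)%type H _ _ _ yE
    (@continuousB R H (R * R)%type _ _ z ky ky')).
Qed.

Lemma slice_point_continuous I : continuous (slice_point I).
Proof.
exact: (@continuous_plane R H 1 I).
Qed.

Lemma slice_regular_holomorphic (O : set H) (f : H -> H) I z :
  open O -> slice_regular O f -> imag_units I -> O (slice_point I z) ->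
  slice_holomorphic_at I (f \o slice_point I) z.
Proof.
move=> oO fO hI Oz; have [[dx dy cx cy] CR] := fO I hI.
set D := slice_point I @^-1` O in dx dy cx cy CR.
have oD : open D.
  by move/continuousP : (@slice_point_continuous I); apply.
have Dz : \forall w \near z, D w by exact: open_nbhs_nbhs.
split.
- by apply: filterS Dz => w Dw; split; [exact: dx|exact: dy].
- apply: filterS Dz => w Dw; have /eqP := CR w Dw.
  by rewrite scaler_eq0 invr_eq0 pnatr_eq0 /= => /eqP.
- exact: (@within_open_continuous (R * R)%type H D _ z oD Oz cx).
- exact: (@within_open_continuous (R * R)%type H D _ z oD Oz cy).
Qed.

(** The two real linear forms whose values on k make a Cauchy-Riemann pair in
    [slice_liouville]; their target is R as a normed module over itself. *)
Definition qcoord_lin (n : nat) (q : H) : R^o := qcoord q n.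
Lemma qcoord_lin_linear n : linear (qcoord_lin n).
Proof. by move=> a p q; rewrite /qcoord_lin qcoordD qcoordZ. Qed.
HB.instance Definition _ n :=
  GRing.isLinear.Build R H R^o _ (qcoord_lin n) (qcoord_lin_linear n).

Definition qmull_lin (n : nat) I (q : H) : R^o := - qcoord (I * q) n.
Lemma qmull_lin_linear n I : linear (qmull_lin n I).
Proof.
move=> a p q; rewrite /qmull_lin mulrDr -scalerAr qcoordD qcoordZ opprD.
by rewrite scalerN.
Qed.
HB.instance Definition _ n I :=
  GRing.isLinear.Build R H R^o _ (qmull_lin n I) (qmull_lin_linear n I).

(** For a coordinate l, the real functions l k and - l (I * k) satisfy the
    Cauchy-Riemann equations: this is the equation of k, multiplied by I and
    simplified with I * I = - 1.  Bounded real pairs are constant. *)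
Lemma slice_liouville I k (M : R) : imag_units I ->
  (forall z, slice_holomorphic_at I k z) -> (forall z, `|k z| <= M) ->
  forall z, k z = k (0, 0).
Proof.
move=> I2 kh kM [x y].
have II q : I * (I * q) = - q by rewrite mulrA -expr2 I2 mulN1r.
have yE z : partial_y k z = I * partial_x k z.
  have [_ /nbhs_singleton + _ _] := kh z.
  move=> /(congr1 (fun q => I * q)).
  by rewrite mulrDr mulr0 II => /eqP; rewrite subr_eq0 => /eqP.
have dx z : is_derive z.1 1 (fun a => k (a, z.2)) (partial_x k z).
  have [/nbhs_singleton[+ _] _ _ _] := kh z.
  by rewrite /partial_x derive1E => /derivableP.
have dy z : is_derive z.2 1 (fun b => k (z.1, b)) (partial_y k z).
  have [/nbhs_singleton[_ +] _ _ _] := kh z.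
  by rewrite /partial_y derive1E => /derivableP.
suff key n : qcoord (k (x, y)) n = qcoord (k (0, 0)) n by apply: quatP.
have l1c : continuous (qcoord_lin n) by exact: qcoord_continuous.
have l2c : continuous (qmull_lin n I).
  apply: (@dist_continuous _ H R^o _ (4 * `|I|)) => p q.
  have -> : qmull_lin n I p - qmull_lin n I q = - qcoord (I * (p - q)) n.
    by rewrite /qmull_lin mulrBr /qcoord !mxE opprD.
  by rewrite normrN; apply: le_trans (ler_qcoord _ _) (qnorm_mul_le _ _).
apply: (@bounded_cauchy_riemann_cst _ (fun a b => qcoord (k (a, b)) n)
  (fun a b => - qcoord (I * k (a, b)) n)
  (fun z => qcoord (partial_x k z) n) (fun z => qcoord (partial_y k z) n)
  (4 * `|I| * M + M)).
- split=> a b.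
  + exact: (is_derive_linear l1c (dx (a, b))).
  + exact: (is_derive_linear l1c (dy (a, b))).
  + by rewrite yE; exact: (is_derive_linear l2c (dx (a, b))).
  + apply: (is_derive_eq (is_derive_linear l2c (dy (a, b)))).
    by rewrite /= /qmull_lin yE II /qcoord mxE opprK.
- move=> z; have [_ _ cx _] := kh z.
  exact: (cvg_comp _ _ cx (@qcoord_continuous _ n _)).
- move=> z; have [_ _ _ cy] := kh z.
  exact: (cvg_comp _ _ cy (@qcoord_continuous _ n _)).
- move=> a b; apply: le_trans (ler_qcoord _ _) _.
  have M0 : 0 <= M by apply: le_trans (kM (0, 0)).
  by apply: le_trans (kM _) _; rewrite lerDr !mulr_ge0.
- move=> a b; rewrite normrN; apply: le_trans (ler_qcoord _ _) _.
  have M0 : 0 <= M by apply: le_trans (kM (0, 0)).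
  apply: le_trans (qnorm_mul_le _ _) _; apply: ler_wpDr => //.
  by rewrite ler_wpM2l// mulr_ge0.
Qed.

End SliceHolomorphic.

(** * Slice regular lifts modulo a lattice are affine *)

Section Normed.
Variables (R : realType) (V : normedModType R).

Lemma open_dist (O : set V) (x : V) : open O -> O x ->
  exists2 e : R, 0 < e & forall y, `|y - x| < e -> O y.
Proof.
rewrite openE => /[apply] /nbhs_ballP[e /= e0 eO]; exists e => // y yx.
by apply: eO; rewrite -ball_normE /ball_ /= distrC.
Qed.

(** Iterating the hypothesis, c t - t *: D is 2 ^ n times its value at
    t / 2 ^ n, and this value is o (t / 2 ^ n). *)
Lemma halving_linear (c : R -> V) (D : V) (T t : R) :
  (forall s, `|s| < T -> c s = c (s / 2) + c (s / 2)) -> c 0 = 0 ->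
  is_derive (0 : R) 1 c D -> `|t| < T -> c t = t *: D.
Proof.
move=> ch c0 [cd cD] tT; apply/eqP; rewrite -subr_eq0 -normr_le0.
pose r s := c s - s *: D.
have rh n : r t = (2 ^+ n) *: r (t / 2 ^+ n).
  elim: n => [|n ->]; first by rewrite expr0 divr1 scale1r.
  have -> : r (t / 2 ^+ n) = 2 *: r (t / 2 ^+ n.+1).
    have tn : t / 2 ^+ n.+1 = t / 2 ^+ n / 2 by rewrite exprSr invfM mulrA.
    rewrite /r tn ch; last first.
      apply: le_lt_trans tT; rewrite normrM ler_piMr// normfV invf_le1.
        by rewrite ger0_norm ?exprn_ge0// exprn_ege1// ler1n.
      by rewrite normr_gt0 expf_neq0.
    by rewrite scalerBr scalerA mulrCA divff// mulr1 scaler_nat mulr2n.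
  by rewrite scalerA -exprSr.
have rsmall (e : R) : 0 < e -> exists2 d : R, 0 < d &
    forall s, `|s| < d -> `|r s| <= e * `|s|.
  move=> e0; move: cd; rewrite /derivable => cd.
  have : h^-1 *: ((c \o shift 0) (h *: 1) - c 0) @[h --> 0^'] --> D.
    by rewrite -cD.
  move/cvgrPdist_lt => /(_ e e0) [d /= d0 dP]; exists d => // s sd.
  have [->|s0] := eqVneq s 0.
    by rewrite /r c0 scale0r subr0 !normr0 mulr0.
  have := dP s; rewrite /ball_ /= sub0r normrN => /(_ sd s0).
  rewrite c0 subr0 addr0 [s *: 1]mulr1 => /ltW.
  rewrite -(ler_pM2r (_ : 0 < `|s|)) ?normr_gt0// mulrC -normrZ scalerBr.
  by rewrite scalerA divff// scale1r distrC.
apply/ler_addgt0Pr => e e0; rewrite add0r -/(r t).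
pose e' := e / (`|t| + 1); have t1 : 0 < `|t| + 1 by rewrite ltr_wpDl.
have [d d0 dP] := rsmall e' (divr_gt0 e0 t1).
have [n nd] : exists n, `|t / 2 ^+ n| < d.
  exists (Num.truncn (`|t| / d)).+1.
  rewrite normrM normfV [X in _ / X]ger0_norm ?exprn_ge0//.
  rewrite ltr_pdivrMr ?exprn_gt0// mulrC -ltr_pdivrMr//.
  apply: lt_trans (truncnS_gt _) _.
  by rewrite -natrX ltr_nat ltn_expl.
rewrite (rh n) normrZ ger0_norm ?exprn_ge0//.
apply: (@le_trans _ _ (2 ^+ n * (e' * `|t / 2 ^+ n|))).
  by rewrite ler_wpM2l ?exprn_ge0// dP.
rewrite normrM normfV [X in _ * (_ * (_ / X))]ger0_norm ?exprn_ge0//.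
have -> : 2 ^+ n * (e' * (`|t| / 2 ^+ n)) = e' * `|t|.
  by rewrite mulrCA [_ * (_ / _)]mulrC mulfVK ?expf_neq0.
rewrite /e' mulrAC ler_pdivrMr// ler_pM2l//.
by rewrite lerDl.
Qed.

End Normed.

Section NormSix.
Variables (R : realType) (V : normedModType R).

Lemma ltr_normB (u v : V) (r s : R) : `|u| < r -> `|v| < s -> `|u - v| < r + s.
Proof. by move=> ur vs; apply: le_lt_trans (ler_normB _ _) _; exact: ltrD. Qed.

Lemma ltr_distDD (p x y : V) (e : R) :
  `|x - p| < e -> `|y - p| < e -> `|x - y| < e + e.
Proof.
move=> xp yp; have -> : x - y = (x - p) - (y - p) by rewrite opprB addrA subrK.
exact: ltr_normB.
Qed.

(** Six errors of size e add up here, which fixes the scale at which the lattice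
    is required to be discrete below. *)
Lemma increments_close (p0 p1 x0 x1 y0 y1 w0 w : V) (e : R) :
  `|x0 - p0| < e -> `|x1 - p1| < e -> `|y0 - p0| < e -> `|y1 - p1| < e ->
  `|w0| < e -> `|w| < e -> `|x1 - x0 - (y1 - y0 - w0) - w| < 6 * e.
Proof.
have E (x y : V) : exists a, x = a + y by exists (x - y); rewrite subrK.
have [[a ->] [b ->]] := (E x0 p0, E x1 p1).
have [[a' ->] [b' ->]] := (E y0 p0, E y1 p1).
rewrite !addrK => ha hb ha' hb' hw0 hw.
have -> : b + p1 - (a + p0) - (b' + p1 - (a' + p0) - w0) - w =
    b - a - (b' - a' - w0) - w.
  have h x y : x + p1 - (y + p0) = (x - y) + (p1 - p0).
    by rewrite opprD addrACA.
  rewrite !h; congr (_ - _).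
  by rewrite [_ + _ - w0]addrAC opprD addrACA subrr addr0.
have -> : 6 * e = (e + e) + ((e + e) + e) + e by ring.
by do !apply: ltr_normB.
Qed.

End NormSix.

Lemma slice_decomposition (R : realType) (q : quaternion R) :
  exists (I : quaternion R) (x y : R),
    imag_units I /\ q = slice_point I (x, y).
Proof.
pose v := Num.sqrt (qcoord q 1 ^+ 2 + qcoord q 2 ^+ 2 + qcoord q 3 ^+ 2).
have v2 : v ^+ 2 = qcoord q 1 ^+ 2 + qcoord q 2 ^+ 2 + qcoord q 3 ^+ 2.
  by rewrite sqr_sqrtr// !addr_ge0// sqr_ge0.
have sq (b c d : R) : b ^+ 2 + c ^+ 2 + d ^+ 2 = 1 ->
    imag_units (quat 0 b c d).
  move=> bcd; rewrite /imag_units /= expr2; apply: quatP.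
  have N1 n : qcoord (- 1 : quaternion R) n = - qcoord (quat (1 : R) 0 0 0) n.
    by rewrite /qcoord mxE.
  split; rewrite N1 !qcoordE; [|ring..].
  by rewrite -bcd; ring.
have spE (b c d x y : R) : slice_point (quat 0 b c d) (x, y) =
    quat x (y * b) (y * c) (y * d).
  have one : 1 = quat 1 0 0 0 :> quaternion R by [].
  rewrite /slice_point one.
  by apply: quatP; split; rewrite !(qcoordD, qcoordZ, qcoordE) /=; ring.
have [v0|v0] := eqVneq v 0.
  exists (quat 0 1 0 0), (qcoord q 0), 0; split.
    by apply: sq; rewrite expr1n expr0n /= !addr0.
  rewrite spE; move: v2; rewrite v0 expr0n /= => /esym/eqP.
  rewrite !paddr_eq0 ?addr_ge0 ?sqr_ge0// !sqrf_eq0.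
  move=> /andP[/andP[/eqP q1 /eqP q2] /eqP q3].
  by apply: quatP; rewrite !qcoordE q1 q2 q3 !mul0r.
exists (quat 0 (qcoord q 1 / v) (qcoord q 2 / v) (qcoord q 3 / v)).
exists (qcoord q 0), v; split.
  by apply: sq; rewrite !expr_div_n -!mulrDl -v2 divff// expf_neq0.
by rewrite spE; apply: quatP; rewrite !qcoordE ![v * _]mulrC !mulfVK.
Qed.

Section AffineLift.
Variables (R : realType) (L : lattice R).
Local Notation H := (quaternion R).

Definition lcong (p q : H) : Prop := lattice_set L (p - q).

Lemma lcong_refl p : lcong p p.
Proof. by rewrite /lcong subrr; exact: lattice0. Qed.

Lemma lcong_sym p q : lcong p q -> lcong q p.
Proof.
move=> pq; have : lattice_rel L q p.
  by rewrite lattice_rel_sym; exact/asboolP.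
by move=> /asboolP.
Qed.

Lemma lcong_trans q p r : lcong p q -> lcong q r -> lcong p r.
Proof.
move=> h1 h2; apply/asboolP; apply: (@lattice_rel_trans R L q); exact/asboolP.
Qed.

Lemma lcongB p q p' q' : lcong p q -> lcong p' q' -> lcong (p - p') (q - q').
Proof.
move=> h h'; have := latticeB h h'; rewrite /lcong.
by rewrite !opprD !opprK addrACA.
Qed.

Lemma lcongD p q p' q' : lcong p q -> lcong p' q' -> lcong (p + p') (q + q').
Proof.
move=> h h'; rewrite -[p']opprK -[q']opprK; apply: lcongB => //.
by rewrite -[- p']sub0r -[- q']sub0r; apply: lcongB => //; exact: lcong_refl.
Qed.

(** Here phi is any choice of representatives for a map to H/L, so that it need
    not be continuous; the local hypothesis provides slice regular functions g
    congruent to phi near each point. *)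
Variables (phi : H -> H) (e d : R).
Hypotheses (e0 : 0 < e) (d0 : 0 < d).
Hypothesis discrete : forall p q : H, lcong p q -> `|p - q| < 6 * e -> p = q.
Hypothesis phi_unif : forall q v : H, `|v| < d ->
  exists2 w, `|w| < e & lcong (phi (q + v) - phi q) w.
Hypothesis phi_local : forall q0 : H, exists (O : set H) (g : H -> H),
  [/\ open O, O q0, slice_regular O g &
      forall q, O q -> lcong (g q) (phi q) /\ `|g q - phi q0| < e].

Lemma slice_pointD (I : H) z w :
  slice_point I (z + w) = slice_point I z + slice_point I w.
Proof. by rewrite /slice_point /= !scalerDl addrACA. Qed.

Lemma slice_pointZ (I : H) t z : slice_point I (t *: z) = t *: slice_point I z.
Proof. by rewrite /slice_point /= scalerDr !scalerA. Qed.

Lemma slice_point0 (I : H) : slice_point I 0 = 0.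
Proof. by rewrite /slice_point /= !scale0r addr0. Qed.

(** The small representative of the increment of phi by a fixed vector of the
    slice is a bounded function on the slice.  Near z0 it equals the
    difference of two local lifts g1 and g0, up to an element of L, which does
    not depend on the point since L is discrete.  So it is holomorphic, and
    Liouville's theorem applies. *)
Lemma slice_step (I : H) s : imag_units I -> `|slice_point I s| < d ->
  exists2 c : H, `|c| < e & forall z,
    lcong (phi (slice_point I (z + s)) - phi (slice_point I z)) c.
Proof.
move=> hI vd; set v := slice_point I s in vd.
have wE q : exists w : H, `|w| < e /\ lcong (phi (q + v) - phi q) w.
  by have [w w1 w2] := phi_unif q vd; exists w.
have [w wP] := choice wE.
have wcst : forall z, w (slice_point I z) = w (slice_point I (0, 0)).
  apply: (@slice_liouville R I (w \o slice_point I) e hI); last first.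
    by move=> z; apply: ltW; case: (wP (slice_point I z)).
  move=> z0; pose q0 := slice_point I z0.
  have [U0 [g0 [oU0 U0q g0r g0P]]] := phi_local q0.
  have [U1 [g1 [oU1 U1q g1r g1P]]] := phi_local (q0 + v).
  have h0 := slice_regular_holomorphic oU0 g0r hI U0q.
  have U1z : U1 (slice_point I (z0 + s)) by rewrite slice_pointD.
  have h1 := slice_holomorphic_shift (slice_regular_holomorphic oU1 g1r hI U1z).
  have h := @slice_holomorphic_sub R I _ _ (g1 (q0 + v) - g0 q0 - w q0) z0
    h1 h0.
  apply: slice_holomorphic_near h.
  have near0 : \forall z \near z0, U0 (slice_point I z).
    exact: (@slice_point_continuous R I z0 U0 (open_nbhs_nbhs (conj oU0 U0q))).
  have near1 : \forall z \near z0, U1 (slice_point I (z + s)).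
    apply: (@near_addr R (R * R)%type (U1 \o slice_point I)).
    exact: (@slice_point_continuous R I (z0 + s) U1
      (open_nbhs_nbhs (conj oU1 U1z))).
  have inc q : U0 q -> U1 (q + v) -> lcong (g1 (q + v) - g0 q) (w q).
    move=> Oq Oqv; apply: lcong_trans (wP q).2.
    by apply: lcongB; [exact: (g1P _ Oqv).1|exact: (g0P _ Oq).1].
  have key q : U0 q -> U1 (q + v) ->
      g1 (q + v) - g0 q - (g1 (q0 + v) - g0 q0 - w q0) = w q.
    move=> Oq Oqv; apply: discrete.
      rewrite -[X in lcong _ X]subr0 -[X in lcong _ (_ - X)](subrr (w q0)).
      apply: lcongB; first exact: inc.
      by apply: lcongB; [exact: inc|exact: lcong_refl].
    apply: (@increments_close _ _ (phi q0) (phi (q0 + v)));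
      [exact: (g0P _ _).2|exact: (g1P _ _).2|exact: (g0P _ _).2
      |exact: (g1P _ _).2|exact: (wP _).1|exact: (wP _).1].
  have kz z : U0 (slice_point I z) -> U1 (slice_point I (z + s)) ->
      (g1 \o slice_point I) (z + s) - (g0 \o slice_point I) z
        - (g1 (q0 + v) - g0 q0 - w q0) = (w \o slice_point I) z.
    by rewrite /= slice_pointD => Oz Ozs; exact: key.
  exact: (@filterS2 _ (nbhs z0) (nbhs_filter z0) _ _ _ kz near0 near1).
exists (w 0); first exact: (wP 0).1.
move=> z; rewrite -(slice_point0 I) -(wcst z) slice_pointD.
exact: (wP _).2.
Qed.

(** By [slice_step] the increment of phi along t *: s is the same at every point
    of the slice; read at 0 it is c t = g (slice_point I (t *: s)) - g 0.
    Composing two half steps gives c t = c (t / 2) + c (t / 2), whence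
    c t = t *: D for small t, and a long step is a sum of short ones. *)
Lemma slice_direction (I : H) (s : R * R) (O : set H) (g : H -> H) (D : H) :
  imag_units I -> open O -> O 0 ->
  (forall q, O q -> lcong (g q) (phi q) /\ `|g q - phi 0| < e) ->
  is_derive (0 : R) 1 (fun t : R => g (slice_point I (t *: s))) D ->
  forall (x : R) z,
    lcong (phi (slice_point I (z + x *: s)) - phi (slice_point I z)) (x *: D).
Proof.
move=> hI oO U0 gP gD.
pose c t := g (slice_point I (t *: s)) - g 0.
have [r r0 rO] := open_dist oO U0.
pose T := Num.min d r / (`|slice_point I s| + 1).
have den : 0 < `|slice_point I s| + 1 by rewrite ltr_wpDl.
have T0 : 0 < T by rewrite divr_gt0// lt_min d0.
have small t : `|t| < T ->
    `|slice_point I (t *: s)| < d /\ O (slice_point I (t *: s)).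
  move=> tT; have : `|slice_point I (t *: s)| < Num.min d r.
    rewrite slice_pointZ normrZ; move: tT; rewrite /T ltr_pdivlMr//.
    by apply: le_lt_trans; rewrite ler_wpM2l// lerDl.
  by rewrite lt_min => /andP[? ?]; split=> //; apply: rO; rewrite subr0.
have cP t z : `|t| < T ->
    lcong (phi (slice_point I (z + t *: s)) - phi (slice_point I z)) (c t).
  move=> /small[td tO]; have [w wn wP] := slice_step hI td.
  suff -> : c t = w by exact: wP.
  apply: discrete.
    apply: lcong_trans (wP 0); rewrite add0r slice_point0.
    by apply: lcongB; [exact: (gP _ tO).1|exact: (gP _ U0).1].
  have := ltr_normB (ltr_distDD (gP _ tO).2 (gP _ U0).2) wn.
  move/lt_trans; apply; rewrite -subr_gt0.
  have -> : 6 * e - (e + e + e) = 3 * e by ring.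
  by rewrite mulr_gt0.
have cn t : `|t| < T -> `|c t| < e + e.
  by move=> /small[_ tO]; exact: ltr_distDD (gP _ tO).2 (gP _ U0).2.
have ch t : `|t| < T -> c t = c (t / 2) + c (t / 2).
  move=> tT; have tT2 : `|t / 2| < T.
    apply: le_lt_trans tT; rewrite normrM normfV [X in _ / X]ger0_norm//.
    by rewrite ler_pdivrMr// ler_peMr// ler1n.
  apply: discrete; last first.
    have -> : 6 * e = (e + e) + ((e + e) + (e + e)) by ring.
    apply: ltr_normB; first exact: cn.
    by apply: le_lt_trans (ler_normD _ _) _; apply: ltrD; exact: cn.
  apply: lcong_trans (lcong_sym (cP t 0 tT)) _.
  have := lcongD (cP (t / 2) ((t / 2) *: s) tT2) (cP (t / 2) 0 tT2).
  by rewrite -scalerDl -splitr !add0r subrKA.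
have cD : is_derive (0 : R) 1 c D.
  have := is_deriveB gD (is_derive_cst (g 0) (0 : R) 1).
  by rewrite subr0.
have c0 : c 0 = 0.
  by rewrite /c scale0r slice_point0 subrr.
have cE t := @halving_linear R H c D T t ch c0 cD.
move=> x z.
have [n nT] : exists n : nat, `|x / n.+1%:R| < T.
  exists (Num.truncn (`|x| / T)).
  rewrite normrM normfV [X in _ / X]ger0_norm// ltr_pdivrMr ?ltr0n//.
  by rewrite mulrC -ltr_pdivrMr// truncnS_gt.
set t := x / n.+1%:R in nT.
have step m : lcong (phi (slice_point I (z + (m%:R * t) *: s))
    - phi (slice_point I z)) ((m%:R * t) *: D).
  elim: m => [|m IH].
    by rewrite mul0r !scale0r addr0 subrr; exact: lcong_refl.
  have := lcongD (cP t (z + (m%:R * t) *: s) nT) IH.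
  rewrite cE// subrKA [t *: D + _]addrC.
  by rewrite -natr1 mulrDl mul1r !scalerDl addrA.
have := step n.+1; rewrite mulrC mulfVK// pnatr_eq0.
Qed.

(** The slope along the real axis does not involve I, and the equation at 0
    makes the slope along I equal to I times it; every quaternion lies in
    some slice. *)
Lemma affine_lift :
  exists a : H, forall q, lcong (phi q - phi 0) (q * a).
Proof.
have [U [g [oU U0 gr gP]]] := phi_local 0.
pose a := derive1 (fun t : R => g (t%:A)) 0.
exists a => q; have [I [x [y [hI ->]]]] := slice_decomposition q.
have U00 : U (slice_point I (0, 0)) by rewrite slice_point0.
have [/nbhs_singleton[dx dy] /nbhs_singleton CR _ _] :=
  slice_regular_holomorphic oU gr hI U00.
have kx : (fun t : R => (g \o slice_point I) (t, 0)) = (fun t => g t%:A).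
  by apply/funext => t; rewrite /= /slice_point /= scale0r addr0.
have xE : partial_x (g \o slice_point I) (0, 0) = a by rewrite /partial_x kx.
have yE : partial_y (g \o slice_point I) (0, 0) = I * a.
  have := CR; rewrite xE => /(congr1 (fun q => I * q)).
  rewrite mulrDr mulr0 mulrA -expr2 hI mulN1r => /eqP.
  by rewrite subr_eq0 => /eqP.
have px (t : R) : t *: ((1, 0) : R * R) = (t, 0).
  by congr (_, _); [exact: mulr1|exact: mulr0].
have py (t : R) : t *: ((0, 1) : R * R) = (0, t).
  by congr (_, _); [exact: mulr0|exact: mulr1].
have hx : is_derive (0 : R) 1 (fun t : R => g (slice_point I (t *: (1, 0)))) a.
  have tx : (fun t : R => g (slice_point I (t *: (1, 0)))) =
      (fun t : R => (g \o slice_point I) (t, 0)).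
    by apply/funext => t; rewrite px.
  by rewrite tx -xE /partial_x derive1E; exact: derivableP dx.
have hy : is_derive (0 : R) 1 (fun t : R => g (slice_point I (t *: (0, 1))))
    (I * a).
  have ty : (fun t : R => g (slice_point I (t *: (0, 1)))) =
      (fun t : R => (g \o slice_point I) (0, t)).
    by apply/funext => t; rewrite py.
  by rewrite ty -yE /partial_y derive1E; exact: derivableP dy.
have sx := slice_direction hI oU U0 gP hx x 0.
have sy := slice_direction hI oU U0 gP hy y (x *: (1, 0)).
have := lcongD sy sx; rewrite add0r subrKA slice_point0.
have -> : x *: ((1, 0) : R * R) + y *: ((0, 1) : R * R) = (x, y).
  by rewrite px py; congr (_, _); [exact: addr0|exact: add0r].
have -> // : y *: (I * a) + x *: a = slice_point I (x, y) * a.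
by rewrite /slice_point /= mulrDl -!scalerAl mul1r addrC.
Qed.

End AffineLift.

(** * Lattices and the topology of tori *)

Section LatticeGeometry.
Variable R : realType.
Local Notation H := (quaternion R).

Lemma quat_sum (q : H) : q = \sum_(j < 4) qcoord q j *: (delta_mx 0 j : H).
Proof.
rewrite [LHS]row_sum_delta; apply: eq_bigr => j _.
by rewrite /qcoord inord_val.
Qed.

Lemma linear_form_bounded (l : {linear H -> R^o}) :
  exists2 C : R, 0 < C & forall q, `|l q| <= C * `|q|.
Proof.
pose C := \sum_(j < 4) `|l (delta_mx 0 j)|.
have C0 : 0 <= C by apply: sumr_ge0.
exists (C + 1); first by rewrite ltr_wpDl.
move=> q; apply: (@le_trans _ _ (C * `|q|)); last by rewrite ler_wpM2r// lerDl.
rewrite {1}[q]quat_sum linear_sum; apply: le_trans (ler_norm_sum _ _ _) _.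
rewrite /C mulr_suml; apply: ler_sum => j _.
by rewrite linearZ normrM mulrC ler_wpM2l// ler_qcoord.
Qed.

Variables (L : set H) (b : 4.-tuple H).
Hypothesis Lb : is_lattice_basis L b.

Lemma lattice_coord q : L q -> forall i, exists m : int, coord b i q = m%:~R.
Proof.
have [fb ->] := Lb => -[m ->] i; exists (m i).
rewrite linear_sum (bigD1 i)//= big1 ?addr0.
  by rewrite raddfMz /= coord_free// eqxx.
by move=> j /negPf ji; rewrite raddfMz /= coord_free// ji mul0rz.
Qed.

Lemma basis_sum q : q = \sum_(i < 4) coord b i q *: b`_i.
Proof.
have [fb _] := Lb; apply: coord_span.
suff -> : <<b>>%VS = fullv by exact: memvf.
apply/eqP; rewrite -dimv_leqif_eq ?subvf//.
by rewrite (eqP fb) size_tuple dimvf.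
Qed.

(** The coordinates in the basis are bounded by a multiple of the norm, so those
    of a short element are integers of absolute value less than 1. *)
Lemma lattice_discrete :
  exists2 r : R, 0 < r & forall q, L q -> `|q| < r -> q = 0.
Proof.
have C (i : 'I_4) : exists c : R, 0 < c /\ forall q, `|coord b i q| <= c * `|q|.
  by have [c c0 cP] := linear_form_bounded (coord b i); exists c.
have [c cP] := choice C.
pose M := \sum_(i < 4) c i.
have cM i : c i <= M.
  by rewrite /M (bigD1 i)//= lerDl sumr_ge0// => j _; have [/ltW] := cP j.
have M0 : 0 < M by apply: lt_le_trans (cM 0); have [] := cP 0.
exists M^-1; first by rewrite invr_gt0.
move=> q Lq qM; rewrite [q]basis_sum big1// => i _.
have [m mE] := lattice_coord Lq i; rewrite mE.
have : `|m%:~R : R| < 1.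
  rewrite -mE; apply: le_lt_trans ((cP i).2 q) _.
  apply: (@le_lt_trans _ _ (M * `|q|)); first by rewrite ler_wpM2r.
  by rewrite mulrC -ltr_pdivlMr// div1r.
rewrite -intr_norm -[1]/(1%:~R) ltr_int => m1.
suff -> : m = 0 by rewrite scale0r.
by move: m1; case: (m) => [[|n]|n].
Qed.

(** Rounding the coordinates in the basis down leaves a point of the fundamental
    parallelepiped. *)
Lemma lattice_cobounded :
  exists M : R, forall q, exists2 l, L l & `|q - l| <= M.
Proof.
have [_ LE] := Lb.
exists (\sum_(i < 4) `|b`_i|) => q.
exists (\sum_(i < 4) b`_i *~ Num.floor (coord b i q)).
  by rewrite LE; exists [ffun i => Num.floor (coord b i q)];
    apply: eq_bigr => i _; rewrite ffunE.
rewrite {1}[q]basis_sum -sumrB; apply: le_trans (ler_norm_sum _ _ _) _.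
apply: ler_sum => i _.
rewrite -scaler_int -scalerBl normrZ ler_piMl//.
rewrite ger0_norm ?subr_ge0 ?ge_floor//.
by rewrite lerBlDr ltW// addrC -[1]/(1%:~R) -intrD floorD1_gt.
Qed.

End LatticeGeometry.

Section TorusTopology.
Variables (R : realType) (L : lattice R).
Local Notation H := (quaternion R).
Local Notation proj := (torus_proj L).

Lemma torus_projP p q : proj p = proj q <-> lcong L p q.
Proof.
split; first by move=> /eqmodP/asboolP.
by move=> h; apply/eqmodP/asboolP.
Qed.

Lemma torus_proj_repr (t : torus L) : proj (repr t) = t.
Proof. exact: reprK. Qed.

Lemma torus_repr_proj p : lcong L (repr (proj p)) p.
Proof. by apply/torus_projP; rewrite torus_proj_repr. Qed.

Lemma torus_proj_continuous : continuous proj.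
Proof. exact: pi_continuous. Qed.

(** The preimage of the image of W is the union of the translates of W. *)
Lemma torus_proj_open (W : set H) : open W -> open (proj @` W).
Proof.
move=> oW; rewrite /open /= /quotient_open.
have -> : \pi_(torus L)%qT @^-1` (proj @` W) =
    \bigcup_(l in lattice_set L) [set q : H | W (q + l)].
  apply/seteqP; split=> [q [w Ww /torus_projP wq]|q [l Ll Wq]].
    by exists (w - q) => //=; rewrite addrC subrK.
  by exists (q + l) => //; apply/torus_projP; rewrite /lcong addrC addKr.
apply: bigcup_open => l _.
have : continuous (fun q : H => q + l).
  apply: (@dist_continuous _ H H _ 1) => x y.
  by rewrite mul1r opprD addrACA subrr addr0.
by move=> /continuousP; apply.
Qed.

(** A union of segments that share the centre. *)
Lemma ball_is_connected (V : normedModType R) (p : V) (e : R) : 0 < e ->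
  connected (ball p e).
Proof.
move=> e0; pose seg q := [set p + t *: (q - p) | t in `[0%R, 1%R]%classic].
have -> : ball p e = \bigcup_(q in ball p e) seg q.
  apply/seteqP; split=> [q pq|_ [q pq [t /itvP t01 <-]]].
    exists q => //; exists 1; first by rewrite /= in_itv /= ler01 lexx.
    by rewrite scale1r addrC subrK.
  rewrite -ball_normE /ball_ /= opprD addNKr.
  move: pq; rewrite -ball_normE /ball_ /= => pq.
  rewrite normrN normrZ ger0_norm ?t01// distrC; apply: le_lt_trans pq.
  by rewrite ler_piMl// t01.
apply: bigcup_connected.
  exists p => q pq; exists 0; first by rewrite /= in_itv /= lexx ler01.
  by rewrite scale0r addr0.
move=> q _; apply: connected_continuous_connected.
  exact: segment_connected.
apply: continuous_subspaceT => t; apply: cvgD; first exact: cvg_cst.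
by apply: cvgZr_tmp; exact: cvg_id.
Qed.

(** Two points of the ball are at distance less than 2 e, so that they cannot
    differ by a nonzero element of L. *)
Lemma ball_chart (p : H) (e : R) : 0 < e ->
  (forall q, lattice_set L q -> `|q| < e + e -> q = 0) ->
  exists psi, is_chart L (ball p e) psi.
Proof.
move=> e0 disc; exists (fun t => xget p [set q | ball p e q /\ proj q = t]).
split; [exact: ball_open| exact: ball_is_connected|].
move=> q; rewrite inE => pq; set A := [set _ | _].
have /(xgetPex p) [pq' /torus_projP qq'] : exists q', A q' by exists q.
apply/eqP; rewrite -subr_eq0; apply/eqP/disc => //.
rewrite -!ball_normE /ball_ /= in pq pq'.
by apply: (@ltr_distDD _ _ p); rewrite distrC.
Qed.

End TorusTopology.

(** * Regular maps between tori *)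

Section RegularMaps.
Variables (R : realType) (L1 L2 : lattice R).
Local Notation H := (quaternion R).

Section Lift.
Variable F : torus L1 -> torus L2.
Hypothesis Fr : regular_map F.

Let phi (q : H) : H := repr (F (torus_proj L1 q)).

Lemma regular_map_local_lift (e : R) (q0 : H) : 0 < e ->
  (forall q : H, lattice_set L2 q -> `|q| < e + e -> q = 0) ->
  exists (O : set H) (g : H -> H), [/\ open O, O q0, slice_regular O g &
    forall q, O q -> lcong L2 (g q) (phi q) /\ `|g q - phi q0| < e].
Proof.
move=> e0 disc2; have [b1 Lb1] := latticeP L1.
have [r r0 disc1] := lattice_discrete Lb1.
have r20 : 0 < r / 2 by rewrite divr_gt0.
rewrite [r]splitr in disc1.
have [psi1 chart1] := @ball_chart R L1 q0 (r / 2) r20 disc1.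
have [psi chart2] := @ball_chart R L2 (phi q0) e e0 disc2.
have [Fc /(_ _ _ _ _ chart1 chart2) sr] := Fr.
set O := _ `&` _ in sr.
exists O, (psi \o F \o torus_proj L1); split=> //.
- apply: openI; first exact: ball_open.
  have : continuous (F \o torus_proj L1).
    move=> q; apply: continuous_comp; last exact: Fc.
    exact: torus_proj_continuous.
  by move=> /continuousP; apply; apply: torus_proj_open; exact: ball_open.
- split; first by apply: ballxx; rewrite divr_gt0.
  by exists (phi q0); [exact: ballxx|exact: torus_proj_repr].
- move=> q [_ /= [w Ww wE]]; have [_ _ psiK] := chart2.
  rewrite -wE psiK ?inE//; split.
    by apply/torus_projP; rewrite wE torus_proj_repr.
  by rewrite distrC; move: Ww; rewrite -ball_normE.
Qed.

(** Since phi is invariant under L1, it suffices to treat the points q of a ball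
    that meets all the classes, and this ball is compact; near each of its
    points, two values of a local lift are within e of each other. *)
Lemma regular_map_unif (e : R) : 0 < e ->
  (forall q : H, lattice_set L2 q -> `|q| < e -> q = 0) ->
  exists2 d : R, 0 < d & forall q v : H, `|v| < d ->
    exists2 w, `|w| < e & lcong L2 (phi (q + v) - phi q) w.
Proof.
move=> e0 disc; have [b1 Lb1] := latticeP L1.
have [M MP] := lattice_cobounded Lb1.
pose P (d : R) (q : H) := forall v : H, `|v| < d ->
  exists2 w, `|w| < e & lcong L2 (phi (q + v) - phi q) w.
pose K := [set q : H | `|q| <= M].
have cK : compact K.
  apply: bounded_closed_compact.
    exists M; split; first exact: num_real.
    by move=> x /ltW Mx q /= /le_trans; apply.
  rewrite (_ : K = (fun q : 'rV[R]_4 => `|q|) @^-1` [set x | x <= M]) //.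
  apply: closed_comp; last exact: closed_le.
  by move=> q _; exact: norm_continuous.
have : \forall d \near (0 : R)^'+, K `<=` P d.
  move/compact_near_coveringP : cK; apply => q0 _.
  have [U [g [oU Uq gr gP]]] : exists (O : set H) (g : H -> H),
      [/\ open O, O q0, slice_regular O g &
    forall q, O q -> lcong L2 (g q) (phi q) /\ `|g q - phi q0| < e / 2].
    by apply: regular_map_local_lift; [rewrite divr_gt0|rewrite -splitr].
  have [r r0 rU] := open_dist oU Uq.
  exists (ball q0 (r / 2), [set d | d < r / 2]) => /=.
    split; first by apply: nbhsx_ballx; rewrite divr_gt0.
    by apply: nbhs_right_lt; rewrite divr_gt0.
  move=> [q d] /= [qq0 dr] v vd.
  have qr : `|q - q0| < r / 2.
    by move: qq0; rewrite -ball_normE /ball_ /= distrC.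
  have Uq1 : U q.
    by apply: rU; apply: lt_trans qr _; rewrite ltr_pdivrMr// ltr_pMr// ltr1n.
  have Uq2 : U (q + v).
    apply: rU; rewrite addrAC [r]splitr; apply: le_lt_trans (ler_normD _ _) _.
    by apply: ltrD => //; apply: lt_trans dr.
  exists (g (q + v) - g q).
    rewrite [e]splitr; apply: ltr_distDD (gP _ Uq2).2 (gP _ Uq1).2.
  by apply: lcong_sym; apply: lcongB; [exact: (gP _ Uq2).1|exact: (gP _ Uq1).1].
move=> nP; have [d [d0 dP]] : exists d : R, 0 < d /\ K `<=` P d.
  near (0 : R)^'+ => d; exists d; split; first by near: d; exact: nbhs_right_gt.
  by near: d.
exists d => // q v vd; have [l Ll lM] := MP q.
have [w we wP] := dP (q - l) lM v vd; exists w => //.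
have per p : phi (p - l) = phi p.
  rewrite /phi; congr (repr (F _)); apply/torus_projP.
  rewrite /lcong addrAC subrr sub0r -sub0r.
  by apply: latticeB => //; exact: lattice0.
by move: wP; rewrite addrAC !per.
Unshelve. all: by end_near. Qed.

Lemma regular_map_affine :
  exists a : H, forall q, F (torus_proj L1 q) = torus_proj L2 (phi 0 + q * a).
Proof.
have [b2 Lb2] := latticeP L2; have [r r0 disc] := lattice_discrete Lb2.
pose e := r / 6; have e0 : 0 < e by rewrite divr_gt0.
have re : r = 6 * e by rewrite /e; field.
have er x : x <= 6 -> x * e <= r by move=> x6; rewrite re ler_pM2r.
have [d d0 dP] : exists2 d : R, 0 < d & forall q v : H, `|v| < d ->
    exists2 w, `|w| < e & lcong L2 (phi (q + v) - phi q) w.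
  apply: regular_map_unif => // q Lq qe; apply: disc => //.
  by apply: lt_le_trans qe _; rewrite -[e]mul1r er// ler1n.
have [] := @affine_lift R L2 phi e d e0 d0 _ dP.
- move=> p q pq; rewrite -re => pqr.
  by apply/eqP; rewrite -subr_eq0; apply/eqP/disc.
- move=> q0; apply: regular_map_local_lift => // q Lq qe; apply: disc => //.
  by apply: lt_le_trans qe _; rewrite -mulr2n -mulr_natl er// ler_nat.
move=> a aP; exists a => q; rewrite -[LHS]torus_proj_repr -/(phi q).
apply/torus_projP; have := lcongD (aP q) (lcong_refl L2 (phi 0)).
by rewrite subrK addrC.
Qed.

End Lift.

End RegularMaps.

(** * Maps of tori induced by right multiplications *)

Lemma is_derive_scalel (R : realType) (V : normedModType R) (a b : V) (x : R) :
  is_derive x 1 (fun t : R => t *: a + b) a.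
Proof.
have da : differentiable ( *:%R^~ a : R -> V) x by [].
have h : is_derive x (1 : R) ( *:%R^~ a : R -> V) a.
  by split; [exact: diff_derivable|rewrite deriveE// diff_val scale1r].
by have := is_deriveD h (is_derive_cst b x 1); rewrite addr0.
Qed.

Lemma pointwise_within_continuous (T U : topologicalType) (A : set T)
    (f : T -> U) :
  (forall x, A x -> {for x, continuous f}) -> {within A, continuous f}.
Proof.
by move=> fA; apply: continuous_in_subspaceT => x /[!inE]; exact: fA.
Qed.

Section Multiplication.
Variables (R : realType).
Local Notation H := (quaternion R).

Lemma slice_holomorphic_affine (I a c : H) z : imag_units I ->
  slice_holomorphic_at I (fun w => slice_point I w * a + c) z.
Proof.
move=> hI; set k := fun w => _.
have kx (y : R) : (fun x => k (x, y)) = (fun x => x *: a + (y *: (I * a) + c)).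
  apply/funext => x; rewrite /k /slice_point /=.
  by rewrite mulrDl -!scalerAl mul1r addrA.
have ky (x : R) : (fun y => k (x, y)) = (fun y => y *: (I * a) + (x *: a + c)).
  apply/funext => y; rewrite /k /slice_point /=.
  by rewrite mulrDl -!scalerAl mul1r addrCA addrA.
have xE : partial_x k = cst a.
  apply/funext => w; rewrite /partial_x kx derive1E.
  by have := @is_derive_scalel R H a (w.2 *: (I * a) + c) w.1; case.
have yE : partial_y k = cst (I * a).
  apply/funext => w; rewrite /partial_y ky derive1E.
  by have := @is_derive_scalel R H (I * a) (w.1 *: a + c) w.2; case.
have kd w : slice_derivable k w.
  split.
    rewrite kx.
    by have := @is_derive_scalel R H a (w.2 *: (I * a) + c) w.1; case.
  by rewrite ky; have := @is_derive_scalel R H (I * a) (w.1 *: a + c) w.2; case.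
have CR w : partial_x k w + I * partial_y k w = 0.
  by rewrite xE yE /= mulrA -expr2 hI mulN1r subrr.
split.
- exact: (@filterE _ (nbhs z) (nbhs_filter z) _ kd).
- exact: (@filterE _ (nbhs z) (nbhs_filter z) _ CR).
- by rewrite xE; exact: (@cst_continuous (R * R)%type H a).
- by rewrite yE; exact: (@cst_continuous (R * R)%type H (I * a)).
Qed.

Lemma slice_regular_of_holomorphic (O : set H) (f : H -> H) :
  (forall I z, imag_units I -> O (slice_point I z) ->
    slice_holomorphic_at I (f \o slice_point I) z) -> slice_regular O f.
Proof.
move=> fh I hI D fI; split.
  split.
  - move=> z Dz; have [kd _ _ _] := fh I z hI Dz.
    exact: (nbhs_singleton kd).1.
  - move=> z Dz; have [kd _ _ _] := fh I z hI Dz.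
    exact: (nbhs_singleton kd).2.
  - apply: (@pointwise_within_continuous (R * R)%type H D (partial_x fI)).
    move=> z Dz; have [_ _ kx _] := fh I z hI Dz; exact: kx.
  - apply: (@pointwise_within_continuous (R * R)%type H D (partial_y fI)).
    move=> z Dz; have [_ _ _ ky] := fh I z hI Dz; exact: ky.
move=> z Dz; have [_ kCR _ _] := fh I z hI Dz.
by rewrite (nbhs_singleton kCR) scaler0.
Qed.

Variables (L1 L2 : lattice R) (a : H).
Hypothesis La : forall q : H, lattice_set L1 q -> lattice_set L2 (q * a).

Definition torus_mul (t : torus L1) : torus L2 := torus_proj L2 (repr t * a).

Lemma torus_mul_proj q : torus_mul (torus_proj L1 q) = torus_proj L2 (q * a).
Proof.
apply/torus_projP; rewrite /lcong -mulrBl; apply: La.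
exact: torus_repr_proj.
Qed.

(** Near a point where the chart psi takes the value w, the expression of the
    map in charts is q |-> q * a + c: since W is open, the point q * a + c
    stays in W, where psi is inverse to the projection. *)
Lemma torus_mul_regular : regular_map torus_mul.
Proof.
split.
  apply/quotient_continuous.
  have -> : torus_mul \o \pi%qT = torus_proj L2 \o (fun q : H => q * a).
    by apply/funext => q; exact: torus_mul_proj.
  move=> q; apply: continuous_comp; first exact: qmulr_continuous.
  exact: torus_proj_continuous.
move=> V phi W psi _ [oW _ psiK].
apply: slice_regular_of_holomorphic => I z hI [_ [w Ww wE]].
have wq : lcong L2 w (slice_point I z * a).
  by apply/torus_projP; rewrite wE; exact: torus_mul_proj.
set c := w - slice_point I z * a.
apply: slice_holomorphic_near (slice_holomorphic_affine a c z hI).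
have cont : continuous (fun x : R * R => slice_point I x * a + c).
  move=> x; apply: cvgD; last exact: cvg_cst.
  exact: (@cvg_comp _ _ _ (slice_point I) (fun q : H => q * a) _ _ _
    (@slice_point_continuous R I x) (@qmulr_continuous R a _)).
have near : \forall x \near z, W (slice_point I x * a + c).
  apply: (cont z W); apply: open_nbhs_nbhs; split => //.
  by rewrite /c addrC subrK.
have key x : W (slice_point I x * a + c) -> slice_point I x * a + c =
    (psi \o torus_mul \o torus_proj L1 \o slice_point I) x.
  move=> Wx; rewrite /= torus_mul_proj -[LHS]psiK ?inE//.
  congr psi; apply/torus_projP; rewrite /lcong addrAC subrr add0r.
  exact: wq.
exact: (@filterS _ (nbhs z) (nbhs_filter z) _ _ key near).
Qed.

End Multiplication.

(** * Multiplications between lattices and integral matrices *)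

Section LatticeMaps.
Variable R : realType.
Local Notation H := (quaternion R).
Implicit Types (L : lattice R) (b : 4.-tuple H).

Lemma basis_mem L b i : is_lattice_basis L b -> lattice_set L (tnth b i).
Proof.
move=> [_ ->]; exists [ffun j => (j == i)%:Z].
rewrite (bigD1 i)//= big1 ?addr0.
  by rewrite ffunE eqxx mulr1z (tnth_nth 0).
by move=> j /negPf ji; rewrite ffunE ji mulr0z.
Qed.

Lemma lattice_mulmx L (m : nat) (v : 'cV[H]_m) (A : 'M[int]_(m, m)) i :
  (forall j, lattice_set L (v j 0)) -> lattice_set L ((map_mx intr A *m v) i 0).
Proof.
move=> Lv; rewrite mxE; elim/big_rec: _ => [|j x _ Lx]; first exact: lattice0.
have [c [_ LE]] := latticeP L.
have Lj : lattice_set L ((map_mx intr A) i j * v j 0).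
  move: (Lv j); rewrite mxE mulrzl LE => -[n ->].
  exists [ffun k => n k * A i j]; rewrite mulrz_suml.
  by apply: eq_bigr => k _; rewrite ffunE mulrzA.
rewrite -[x]opprK -[- x]sub0r; apply: latticeB => //.
by apply: latticeB => //; exact: lattice0.
Qed.

Lemma lattice_span_matrix L b (v : 'cV[H]_4) : is_lattice_basis L b ->
  (forall i, lattice_set L (v i 0)) ->
  exists A : 'M[int]_4, v = map_mx intr A *m \col_j tnth b j.
Proof.
move=> [_ LE] Lv; rewrite LE in Lv.
have [n nE] := choice Lv; exists (\matrix_(i, j) n i j).
apply/matrixP => i j; rewrite ord1 nE mxE; apply: eq_bigr => k _.
by rewrite !mxE mulrzl (tnth_nth 0).
Qed.

Lemma free_matrix_eq1 b (A : 'M[int]_4) : free b ->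
  \col_j tnth b j = map_mx intr A *m \col_j tnth b j :> 'cV[H]_4 -> A = 1%:M.
Proof.
move=> fb /matrixP bE; apply/matrixP => i j; rewrite mxE.
have := bE i 0; rewrite !mxE => /(congr1 (coord b j)).
rewrite linear_sum (tnth_nth 0) coord_free//.
under eq_bigr do rewrite !mxE mulrzl raddfMz /= (tnth_nth 0) coord_free//.
rewrite (bigD1 j)//= eqxx big1 ?addr0; last first.
  by move=> k /negPf ->; rewrite mul0rz.
by move=> h; apply/eqP; rewrite -(eqr_int R) -h; case: (i == j).
Qed.

Lemma col_mulr (v : 'I_4 -> H) (a : H) :
  \col_i (v i * a) = map_mx ( *%R^~ a) (\col_i v i).
Proof. by apply/matrixP => i j; rewrite !mxE. Qed.

Lemma mulmx_colr (A : 'M[H]_4) (v : 'cV[H]_4) (a : H) :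
  A *m map_mx ( *%R^~ a) v = map_mx ( *%R^~ a) (A *m v).
Proof.
apply/matrixP => i j; rewrite !mxE mulr_suml.
by apply: eq_bigr => k _; rewrite mxE mulrA.
Qed.

Lemma map_mulrK (a : H) (v : 'cV[H]_4) : a != 0 ->
  map_mx ( *%R^~ a^-1) (map_mx ( *%R^~ a) v) = v.
Proof. by move=> a0; apply/matrixP => i j; rewrite !mxE mulrK. Qed.

Lemma basis_image L1 L2 (alpha : 4.-tuple H) (a : H) :
  is_lattice_basis L1 alpha ->
  (forall i, lattice_set L2 (tnth alpha i * a)) ->
  forall q, lattice_set L1 q -> lattice_set L2 (q * a).
Proof.
move=> [_ LE] h q; rewrite LE => -[n ->]; rewrite mulr_suml.
pose A : 'M[int]_4 := \matrix_(i, j) n j.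
have := @lattice_mulmx L2 _ (\col_j (tnth alpha j * a)) A 0.
rewrite mxE; under eq_bigr do rewrite !mxE mulrzl (tnth_nth 0).
under [X in _ -> lattice_set L2 X]eq_bigr do rewrite mulrzAl.
by apply=> j; rewrite mxE.
Qed.

(** The matrix B that expresses the basis of L2 times the inverse of a in the
    basis of L1 satisfies A *m B = 1, by freeness; both determinants are
    integers. *)
Lemma matrix_of_lattices L1 L2 (alpha omega : 4.-tuple H) (a : H) :
  is_lattice_basis L1 alpha -> is_lattice_basis L2 omega -> a != 0 ->
  (forall q, lattice_set L1 q -> lattice_set L2 (q * a)) ->
  (forall q, lattice_set L2 q -> lattice_set L1 (q * a^-1)) ->
  exists2 A : 'M[int]_4, \det A = 1 \/ \det A = -1 &
    map_mx intr A *m \col_(i < 4) tnth omega i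
      = \col_(i < 4) (tnth alpha i * a).
Proof.
move=> b1 b2 a0 La Lb.
have [A AE] : exists A : 'M[int]_4,
    \col_i (tnth alpha i * a) = map_mx intr A *m \col_j tnth omega j.
  by apply: (lattice_span_matrix b2) => i; rewrite mxE; apply/La/basis_mem.
have [B BE] : exists B : 'M[int]_4,
    \col_i (tnth omega i * a^-1) = map_mx intr B *m \col_j tnth alpha j.
  by apply: (lattice_span_matrix b1) => i; rewrite mxE; apply/Lb/basis_mem.
exists A; last exact/esym.
have AB : A *m B = 1%:M.
  apply: (@free_matrix_eq1 alpha); first by case: b1.
  rewrite map_mxM -mulmxA -BE col_mulr mulmx_colr -AE col_mulr.
  by rewrite (@map_mulrK a).
have := congr1 determinant AB; rewrite det_mulmx det1 mulrC.
by move=> /intUnitRing.unitzPl/orP[]/eqP ->; [left|right].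
Qed.

Lemma lattices_of_matrix L1 L2 (alpha omega : 4.-tuple H) (a : H)
    (A : 'M[int]_4) :
  is_lattice_basis L1 alpha -> is_lattice_basis L2 omega -> a != 0 ->
  \det A = 1 \/ \det A = -1 ->
  map_mx intr A *m \col_(i < 4) tnth omega i
    = \col_(i < 4) (tnth alpha i * a) ->
  (forall q, lattice_set L1 q -> lattice_set L2 (q * a)) /\
  (forall q, lattice_set L2 q -> lattice_set L1 (q * a^-1)).
Proof.
move=> b1 b2 a0 dA AE.
have uA : A \in unitmx by rewrite unitmxE; case: dA => ->.
split; [apply: basis_image b1 _ => i|apply: basis_image b2 _ => i].
  have := @lattice_mulmx L2 _ (\col_j tnth omega j) A i.
  by rewrite AE mxE; apply=> j; rewrite mxE; exact: basis_mem.
have := congr1 (fun v => map_mx ( *%R^~ a^-1) (map_mx intr (invmx A) *m v)) AE.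
rewrite mulmxA -map_mxM mulVmx// map_mx1 mul1mx.
rewrite -mulmx_colr col_mulr map_mulrK// => /matrixP/(_ i 0).
rewrite !mxE => ->.
have := @lattice_mulmx L1 _ (\col_j tnth alpha j) (invmx A) i.
by rewrite mxE; apply=> j; rewrite mxE; exact: basis_mem.
Qed.

Lemma torus_mulK L1 L2 (a : H) : a != 0 ->
  (forall q, lattice_set L1 q -> lattice_set L2 (q * a)) ->
  (forall q, lattice_set L2 q -> lattice_set L1 (q * a^-1)) ->
  cancel (@torus_mul R L1 L2 a) (@torus_mul R L2 L1 a^-1).
Proof.
move=> a0 La Lb t; rewrite -[t]torus_proj_repr.
by rewrite !torus_mul_proj// mulrK.
Qed.

(** For an affine lift q |-> c + q * a, a point q has the image of 0 exactly
    when q * a is in L2, and by injectivity exactly when q is in L1. *)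
Lemma injective_regular_map L1 L2 (F : torus L1 -> torus L2) :
  regular_map F -> injective F ->
  exists a : H, [/\ a != 0,
    forall q, lattice_set L1 q -> lattice_set L2 (q * a) &
    forall q, lattice_set L2 q -> lattice_set L1 (q * a^-1)].
Proof.
move=> Fr Finj; have [a aP] := regular_map_affine Fr.
set c := repr _ in aP.
have fib q : lattice_set L2 (q * a) <-> lattice_set L1 q.
  have E : (F (torus_proj L1 q) = F (torus_proj L1 0)) <->
      lattice_set L2 (q * a).
    rewrite !aP mul0r addr0; split=> [/torus_projP|h].
      by rewrite /lcong addrAC subrr add0r.
    by apply/torus_projP; rewrite /lcong addrAC subrr add0r.
  rewrite -E; split=> [/Finj/torus_projP|h]; first by rewrite /lcong subr0.
  by congr F; apply/torus_projP; rewrite /lcong subr0.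
have a0 : a != 0.
  (* Otherwise L1 would contain every quaternion, such as a short multiple of
     1. *)
  apply/eqP => az; have [b1 Lb1] := latticeP L1.
  have [r r0 disc] := lattice_discrete Lb1.
  have n1 : 0 < `|1 : H| by rewrite normr_gt0 oner_neq0.
  pose q : H := (r / 2 / `|1 : H|) *: 1.
  have : q = 0.
    apply: disc; first by apply/fib; rewrite az mulr0; exact: lattice0.
    rewrite normrZ ger0_norm ?divr_ge0 ?(ltW r0)// mulfVK ?gt_eqF//.
    by rewrite ltr_pdivrMr// ltr_pMr// ltr1n.
  move/eqP; rewrite scaler_eq0 oner_eq0 orbF mulf_eq0 invr_eq0 (gt_eqF n1) orbF.
  by rewrite mulf_eq0 gt_eqF//= invr_eq0 pnatr_eq0.
exists a; split=> // q Lq; first exact/fib.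
by apply/fib; rewrite mulrVK.
Qed.

End LatticeMaps.

Theorem theorem5p1 (R : realType) (L1 L2 : lattice R)
    (alpha omega : 4.-tuple (quaternion R))
    (halpha : is_lattice_basis L1 alpha) (homega : is_lattice_basis L2 omega) :
  equivalent_tori L1 L2 <->
  exists (a : quaternion R) (A : 'M[int]_4),
    [/\ a != 0, \det A = 1 \/ \det A = -1 &
        map_mx intr A *m \col_(i < 4) tnth omega i
        = \col_(i < 4) (tnth alpha i * a)].
Proof.
split=> [[F [Fr [G [FG _ _]]]]|[a [A [a0 dA AE]]]].
  have [a [a0 La Lb]] := injective_regular_map Fr (can_inj FG).
  have [A dA AE] := matrix_of_lattices halpha homega a0 La Lb.
  by exists a, A.
have [La Lb] := lattices_of_matrix halpha homega a0 dA AE.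
exists (@torus_mul R L1 L2 a); split; first exact: torus_mul_regular.
exists (@torus_mul R L2 L1 a^-1); split.
- exact: torus_mulK.
- have := @torus_mulK R L2 L1 a^-1; rewrite invrK; apply => //.
  by rewrite invr_eq0.
- exact: torus_mul_regular.
Qed.
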